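(* For each integer $r \ge 5316$ with $r \equiv 0$ or $1 \pmod 4$, there exists a pentagonal geometry $\mathrm{PENT}(4,r)$ with a deficiency graph of girth at least $5$ and a best possible identifying code.
   Context: A partial linear space is a (finite) set of points together with a set of lines, each line identified with the set of points incident with it, such that two distinct points lie on at most one common line. Two points are collinear if some line contains both (so a point that lies on a line is collinear with itself). A pentagonal geometry $\mathrm{PENT}(k,r)$ is a partial linear space in which every line has exactly $k$ points, every point is on exactly $r$ lines, and for every point $x$ the set of points not collinear with $x$ is (the point set of) a line of the geometry. Its deficiency graph has the points of the geometry as vertices, with $x \sim y$ precisely when $x$ and $y$ are not collinear; it is $k$-regular with $(k-1)r + k + 1$ vertices. For a graph $G$, $N(x)$ denotes the (open) set of neighbours of $x$. A set $S \subseteq V(G)$ is an identifying code for $G$ if the sets $N(x) \cap S$, $x \in V(G)$, are pairwise distinct. An identifying code $S$ for a $w$-regular graph with $v$ vertices is best possible if $|S| = \left\lceil 2(v-1)/(w+1) \right\rceil$. A (best possible) identifying code for a geometry is a (best possible) identifying code for its deficiency graph. *)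

(* Defs.v *)
From mathcomp Require Import all_boot all_order all_algebra.

Set Implicit Arguments.
Unset Strict Implicit.
Unset Printing Implicit Defensive.

Import Order.TTheory GRing.Theory Num.Theory.

Section Graphs.

Variables (T : finType) (e : rel T).

Definition nbhd (x : T) : {set T} := [set y | e x y].

Definition regular_graph (w : nat) : Prop := forall x : T, #|nbhd x| = w.

(* A graph cycle is a duplicate-free closed walk of length at least 3; the     *)
(* girth of an acyclic graph is infinite.                                      *)
Definition girth_at_least (g : nat) : Prop :=
  forall c : seq T, ucycle e c -> 3 <= size c -> g <= size c.

(* Open neighbourhoods; the empty trace on S is allowed (for one vertex).      *)
Definition identifying_code (S : {set T}) : Prop :=
  injective (fun x => nbhd x :&: S).

Definition best_possible_code (w : nat) (S : {set T}) : Prop :=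
  [/\ regular_graph w, identifying_code S
    & (#|S|%:Z = Num.ceil (2 * (#|T|%:R - 1) / (w%:R + 1) : rat))%R].

End Graphs.

Section Geometries.

Variables (T : finType) (L : {set {set T}}).

Definition partial_linear_space : Prop :=
  forall x y : T, x != y -> forall l m : {set T}, l \in L -> m \in L ->
    x \in l -> y \in l -> x \in m -> y \in m -> l = m.

Definition collinear : rel T :=
  [rel x y | [exists l in L, (x \in l) && (y \in l)]].

Definition deficiency : rel T := [rel x y | ~~ collinear x y].

(* Without nonemptiness, T = void with no lines would be a PENT(k, r) for all  *)
(* k and r, violating the point count (k - 1) r + k + 1.                       *)
Record pentagonal_geometry (k r : nat) : Prop := PentagonalGeometry {
  pent_nonempty : 0 < #|T|;
  pent_pls : partial_linear_space;
  pent_line_size : forall l : {set T}, l \in L -> #|l| = k;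
  pent_point_degree : forall x : T, #|[set l in L | x \in l]| = r;
  pent_opposite_line : forall x : T, [set y | ~~ collinear x y] \in L
}.

End Geometries.

(* Main.v *)
(* In a graph of girth at least 5 the vertex neighbourhoods cover exactly the
   pairs at distance 2, so a PENT(4, r) whose deficiency graph has girth at least
   5 is a 4-regular graph of girth at least 5 together with a decomposition of its
   graph of pairs at distance at least 3 into copies of K4.  Hence such geometries
   can be put on the groups of a 4-GDD, and the deficiency graphs are then disjoint.
   If every group but one carries a code of exactly 2/5 of its points with no empty
   trace (here the groups of size 65 and 80 do), then a best possible code in the
   last group extends to a best possible code of the whole geometry.

   The last group has size M = 56, 68, 80, 92 or 104 when the number v of points is
   even, and for v odd it is obtained from a 4-GDD of type 65^9 M^1.  Wilson's
   construction on transversal designs over F_8 and F_13 gives 4-GDDs of types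
   80^6 y^1 and 65^12 y^1, that is, 480 or 780 points around a hole of size y;
   truncated transversal designs over F_q, with weight 60 and with the hole added to
   every group, turn these into 60 n points around a hole of size y for every
   n >= 212.  The small designs and geometries all have a cyclic group of
   automorphisms and were found by computer. *)

Require Import Defs.
From mathcomp Require Import all_boot all_order all_algebra finfield.
From mathcomp Require Import zify ring lra.

Set Implicit Arguments.
Unset Strict Implicit.
Unset Printing Implicit Defensive.

Import Order.TTheory GRing.Theory Num.Theory.

(** * K4-decompositions and group divisible designs *)

(** Both orders of a pair are constrained, so [e] is symmetric off the diagonal; the diagonal is
    left free, which allows the simplest formula for [e]. *)
Definition decomposable (T : finType) (e : rel T) : Prop :=
  exists L : {set {set T}}, (forall l, l \in L -> #|l| = 4) /\
    forall x y, x != y -> #|[set l in L | (x \in l) && (y \in l)]| = e x y.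

Lemma eq_decomposable (T : finType) (e e' : rel T) :
  (forall x y, x != y -> e x y = e' x y) -> decomposable e -> decomposable e'.
Proof.
move=> ee' [L [L4 Le]]; exists L; split=> // x y xy; by rewrite Le // ee'.
Qed.

(** The sum condition makes the graphs [e j] a partition of the edges of [e0]. Hence all blocks
    through a given pair come from a single [L j], and the union of the [L j] counts nothing
    twice. *)
Lemma decomposable_sum (T J : finType) (e : J -> rel T) (e0 : rel T) :
  (forall j, decomposable (e j)) ->
  (forall x y, x != y -> \sum_j (e j x y : nat) = e0 x y) -> decomposable e0.
Proof.
move=> /fin_all_exists [L LP] e0E.
exists (\bigcup_j L j); split=> [l /bigcupP[j _]|x y xy]; first by have [+ _] := LP j; apply.
have cardL j : #|[set l in L j | (x \in l) && (y \in l)]| = e j x y by have [_ ->] := LP j.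
have setE : [set l in \bigcup_j L j | (x \in l) && (y \in l)] =
            \bigcup_j [set l in L j | (x \in l) && (y \in l)].
  apply/setP=> l; rewrite inE; apply/andP/bigcupP.
    by move=> [/bigcupP[j _ lj] lxy]; exists j; rewrite // inE lj.
  by move=> [j _]; rewrite inE => /andP[lj ->]; split=> //; apply/bigcupP; exists j.
have := e0E x y xy; rewrite setE; case: (e0 x y) => /=; last first.
  move=> /eqP; rewrite sum_nat_eq0 => /forallP e_0.
  rewrite big1 ?cards0 // => j _; apply/eqP; rewrite -cards_eq0 cardL.
  by have := e_0 j; rewrite implyTb.
move=> sum1.
have [j ej] : exists j, e j x y.
  apply/existsP; apply: contra_eqT sum1; rewrite negb_exists => /forallP ne.
  by rewrite big1 // => j _; rewrite (negPf (ne j)).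
have ek k : k != j -> e k x y = false.
  move=> kj; apply/negP => ek; move: sum1.
  by rewrite (bigD1 j) //= (bigD1 k) //= ej ek.
rewrite (bigD1 j) //= big1 ?setU0 ?cardL ?ej // => k kj.
by apply/eqP; rewrite -cards_eq0 cardL ek.
Qed.

Lemma decomposable_inj (T T' : finType) (f : T' -> T) (e : rel T) (e' : rel T') :
    injective f -> (forall x y, x != y -> e (f x) (f y) = e' x y) ->
    (forall x y, x != y -> e x y -> (x \in codom f) && (y \in codom f)) ->
  decomposable e' -> decomposable e.
Proof.
move=> f_inj fe codf [L [L4 Le]].
have im_inj : injective (fun l : {set T'} => f @: l) by apply: imset_inj.
exists [set f @: (l : {set T'}) | l in L]; split=> [_ /imsetP[l lL ->]|x y xy].
  by rewrite card_imset ?L4.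
have [/andP[/codomP[x' xE] /codomP[y' yE]]|ncod] := boolP ((x \in codom f) && (y \in codom f)).
  have xy' : x' != y' by apply: contra_neq xy; rewrite xE yE => ->.
  rewrite xE yE fe // -Le // -(card_imset _ im_inj); congr #|pred_of_set _|.
  apply/setP=> l; rewrite inE; apply/andP/imsetP.
    move=> [/imsetP[l' l'L ->]]; rewrite !mem_imset // => l'xy.
    by exists l' => //; rewrite inE l'L.
  by move=> [l']; rewrite inE => /andP[l'L l'xy] ->; rewrite !mem_imset.
have -> : e x y = false by apply/negP => /(codf _ _ xy); rewrite (negPf ncod).
apply/eqP; rewrite cards_eq0; apply/eqP/setP=> l; rewrite !inE; apply/negP.
move=> /and3P[/imsetP[l' _ ->] /imsetP[x' _ xE] /imsetP[y' _ yE]].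
by move/negP: ncod; apply; rewrite xE yE !codom_f.
Qed.

Lemma decomposable0 (T : finType) (e : rel T) :
  (forall x y, x != y -> e x y = false) -> decomposable e.
Proof.
move=> e0; exists set0; split=> [l|x y xy]; first by rewrite inE.
by rewrite e0 //; apply/eqP; rewrite cards_eq0; apply/eqP/setP=> l; rewrite !inE.
Qed.

(* A 4-GDD with group sizes [w]; its point set and groups are universally
   quantified, so that a design can be placed on any vertex set. *)
Definition gdd (I : finType) (w : I -> nat) : Prop :=
  forall (T : finType) (A : {set T}) (c : T -> I),
    (forall i, #|[set x in A | c x == i]| = w i) ->
  decomposable [rel x y | [&& x \in A, y \in A & c x != c y]].

Lemma eq_gdd (I : finType) (w w' : I -> nat) : w =1 w' -> gdd w -> gdd w'.
Proof. by move=> ww' gw T A c cA; apply: gw => i; rewrite cA ww'. Qed.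

(** One model is enough, since groups of equal size can be matched point by point. *)
Lemma gdd_intro (I T0 : finType) (w : I -> nat) (c0 : T0 -> I) :
  (forall i, #|[set x | c0 x == i]| = w i) ->
  decomposable [rel x y | c0 x != c0 y] -> gdd w.
Proof.
move=> c0w dec0 T A c cA.
have [t0 _|T0'] := pickP (@predT T); last first.
  by apply: decomposable0 => x; have := T0' x.
pose B i := [set x | c0 x == i]; pose C i := [set x in A | c x == i].
have BC i : #|B i| = #|C i| by rewrite c0w cA.
(* The n-th point of each group of the model goes to the n-th point of the corresponding group in
   [A]; by [idx] the default [t0] is never reached. *)
pose f x := nth t0 (enum (C (c0 x))) (index x (enum (B (c0 x)))).
have idx x : index x (enum (B (c0 x))) < size (enum (C (c0 x))).
  by rewrite -cardE -BC cardE index_mem mem_enum inE.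
have fC x : f x \in C (c0 x) by rewrite -mem_enum mem_nth.
have fA x : f x \in A by have := fC x; rewrite inE => /andP[].
have cf x : c (f x) = c0 x by have := fC x; rewrite inE => /andP[_ /eqP].
have f_inj : injective f.
  move=> x y fxy; have cxy : c0 x = c0 y by rewrite -!cf fxy.
  move: fxy (idx x) (idx y); rewrite /f cxy => /eqP fxy ix iy.
  move: fxy; rewrite nth_uniq ?enum_uniq // => /eqP ixy.
  have xB : x \in enum (B (c0 y)) by rewrite mem_enum inE cxy.
  have yB : y \in enum (B (c0 y)) by rewrite mem_enum inE.
  by have := nth_index x xB; rewrite ixy nth_index.
have codC i : C i \subset codom f.
  have imB : f @: B i \subset C i.
    by apply/subsetP=> _ /imsetP[x + ->]; rewrite inE => /eqP <-.
  have /eqP <- : f @: B i == C i by rewrite eqEcard imB card_imset // BC leqnn.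
  by apply/subsetP=> _ /imsetP[x _ ->]; exact: codom_f.
have codA x : x \in A -> x \in codom f.
  by move=> xA; apply: (subsetP (codC (c x))); rewrite inE xA eqxx.
apply: (decomposable_inj f_inj) dec0 => [x y _|x y _] /=; first by rewrite !fA !cf.
by case/and3P=> /codA -> /codA ->.
Qed.

(** Groups outside the image of [phi] are empty, so on [A] the colouring factors through [phi]. *)
Lemma gdd_reindex (I I' : finType) (phi : I' -> I) (w : I -> nat) :
    injective phi -> (forall i, i \notin codom phi -> w i = 0) ->
  gdd (w \o phi) -> gdd w.
Proof.
move=> phi_inj w0 gw T A c cA.
have cphi x : x \in A -> c x \in codom phi.
  move=> xA; apply/negPn/negP => /w0 wc; have := cA (c x); rewrite wc => /eqP.
  by rewrite cards_eq0 => /eqP/setP/(_ x); rewrite !inE xA eqxx.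
have [A0|[x0 x0A]] := set_0Vmem A.
  by apply: decomposable0 => x y _; rewrite /= A0 inE.
have [i0 _] := codomP (cphi _ x0A).
pose c' x := odflt i0 [pick i | phi i == c x].
have c'E x : x \in A -> phi (c' x) = c x.
  move=> /cphi/codomP[i ci]; rewrite /c'; case: pickP => [j /eqP|/(_ i)] //=.
  by rewrite ci eqxx.
apply: eq_decomposable (gw T A c' _) => [x y _|i] /=.
  case xA: (x \in A); case yA: (y \in A) => //=.
  by rewrite -(c'E x xA) -(c'E y yA) (inj_eq phi_inj).
rewrite -cA; congr #|pred_of_set _|; apply/setP=> x; rewrite !inE.
by case xA: (x \in A) => //=; rewrite -(c'E x xA) (inj_eq phi_inj).
Qed.

Lemma card_tag_eq (X : finType) (h : X -> nat) x :
  #|[set p : {x : X & 'I_(h x)} | tag p == x]| = h x.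
Proof.
have Tagged_inj : injective (fun t : 'I_(h x) => Tagged (fun x => 'I_(h x)) t).
  by move=> t t' /eqP; rewrite eq_Tagged => /eqP.
rewrite -[RHS]card_ord -(card_imset _ Tagged_inj).
apply: eq_card => p; rewrite !inE; apply/eqP/imsetP => [|[t _ ->] //].
by case: p => y t /= yx; rewrite -yx; exists t.
Qed.

(* Wilson's fundamental construction: every point [x] of a master design with
   groups [cl] and blocks [B] gets the weight [h x]. *)
Lemma gdd_wfc (X I J : finType) (cl : X -> I) (B : J -> {set X}) (h : X -> nat) :
    (forall x y, x != y -> #|[set j | (x \in B j) && (y \in B j)]| = (cl x != cl y)) ->
    (forall j, gdd (fun x => if x \in B j then h x else 0)) ->
  gdd (fun i => \sum_(x | cl x == i) h x).
Proof.
move=> Bcl gB; pose T0 := {x : X & 'I_(h x)}.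
apply: (@gdd_intro I T0 _ (fun p => cl (tag p))) => [i|].
  rewrite -sum1_card (partition_big (fun p : T0 => tag p) (fun x => cl x == i)) /=; last first.
    by move=> p; rewrite inE.
  apply: eq_bigr => x clx; rewrite sum1_card -[RHS]card_tag_eq; apply: eq_card => p.
  rewrite !inE unfold_in /= inE; have [->|_] := eqVneq (tag p) x; first by rewrite clx.
  exact: andbF.
apply: (@decomposable_sum _ J
  (fun j => [rel p q : T0 | [&& tag p \in B j, tag q \in B j & tag p != tag q]])).
  move=> j; have := gB j T0 [set p | tag p \in B j] (fun p => tag p).
  have cardB x : #|[set p in [set p : T0 | tag p \in B j] | tag p == x]| =
      if x \in B j then h x else 0.
    case: ifP => xB.
      rewrite -[RHS]card_tag_eq; apply: eq_card => p; rewrite !inE.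
      by case: eqP => [->|]; rewrite ?andbF ?xB.
    apply/eqP; rewrite cards_eq0; apply/eqP/setP=> p; rewrite !inE.
    by case: eqP => [->|]; rewrite ?andbF ?xB.
  by move=> /(_ cardB); apply: eq_decomposable => p q _ /=; rewrite !inE.
move=> p q pq /=; have [-> |pq'] := eqVneq (tag p) (tag q).
  by rewrite eqxx big1 // => j _; rewrite !andbF.
rewrite -(Bcl _ _ pq') -sum1_card [RHS]big_mkcond /=; apply: eq_bigr => j _.
by rewrite inE andbT; case: (_ && _).
Qed.

(* [f j i] is the point where block [j] of a transversal design meets group [i]. *)
Definition orthogonal_array (k q : nat) : Prop :=
  exists f : 'I_q * 'I_q -> 'I_k -> 'I_q,
    forall i i', i != i' -> injective (fun j => (f j i, f j i')).

Lemma gdd_td (k q : nat) (h : 'I_k -> 'I_q -> nat) :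
    orthogonal_array k q -> (forall j : 'I_k -> 'I_q, gdd (fun i => h i (j i))) ->
  gdd (fun i => \sum_u h i u).
Proof.
move=> [f f_inj] gh.
have := @gdd_wfc ('I_k * 'I_q)%type 'I_k ('I_q * 'I_q)%type fst
  (fun j => [set p | f j p.1 == p.2]) (fun p => h p.1 p.2).
move=> gX; apply: eq_gdd (gX _ _) => [i|[i u] [i' u'] xy|j] /=.
- transitivity (\sum_(i' | i' == i) \sum_u h i' u); last exact: big_pred1_eq.
  by rewrite pair_big_dep; apply: eq_bigl => p; rewrite andbT.
- have [ii'|ii'] := eqVneq i i'.
    rewrite -{}ii' in xy *; apply/eqP; rewrite cards_eq0.
    apply/eqP/setP=> j; rewrite !inE /=; apply/negP.
    by move=> /andP[/eqP fu /eqP fu']; rewrite -fu -fu' eqxx in xy.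
  (* An injection of the [q * q] blocks into the [q * q] pairs of positions is a bijection, so
     exactly one block passes through both points. *)
  have [g fg gf] := injF_bij (f_inj _ _ ii').
  apply/eqP/cards1P; exists (g (u, u')); apply/setP=> j; rewrite !inE /=.
  apply/andP/eqP => [[/eqP <- /eqP <-]|->]; first by rewrite fg.
  by have [-> ->] := gf (u, u').
- have phi_inj : injective (fun i => (i, f j i)) by move=> i i' [].
  apply: (gdd_reindex phi_inj) => [[i u]|].
    rewrite inE /=; case: eqP => // <- /negP[]; exact: (codom_f (fun i => (i, f j i))).
  by apply: eq_gdd (gh (f j)) => i /=; rewrite inE /= eqxx.
Qed.

(** The blocks are the lines $y = ax + b$ and the groups are [k] distinct abscissae: two points with
    distinct abscissae determine $a$ and $b$. *)
Lemma orthogonal_array_field (F : finFieldType) (k : nat) :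
  k <= #|F| -> orthogonal_array k #|F|.
Proof.
move=> kF; pose u (i : 'I_k) : F := enum_val (widen_ord kF i).
pose f (j : 'I_#|F| * 'I_#|F|) i := enum_rank (enum_val j.1 * u i + enum_val j.2)%R.
exists f => i i' ii' [a b] [a' b'] [] /enum_rank_inj /= eqi /enum_rank_inj /= eqi'.
have uii' : (u i - u i' != 0)%R.
  by rewrite subr_eq0; apply: contra_neq ii' => /enum_val_inj /(congr1 val) /= /val_inj.
have aa' : enum_val a = enum_val a'.
  apply: (mulIf uii').
  have -> : (enum_val a * (u i - u i') =
    (enum_val a * u i + enum_val b) - (enum_val a * u i' + enum_val b))%R by ring.
  rewrite eqi eqi'; ring.
have bb' : enum_val b = enum_val b' by move: eqi; rewrite aa' => /addrI.
by rewrite (enum_val_inj aa') (enum_val_inj bb').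
Qed.

Lemma orthogonal_array_prime_power (k p e : nat) :
  prime p -> 0 < e -> k <= p ^ e -> orthogonal_array k (p ^ e).
Proof.
move=> p_prime e_gt0; have [F _ cardF] := PrimePowerField p_prime e_gt0.
by rewrite -cardF; apply: orthogonal_array_field.
Qed.

Lemma gdd_block4 : gdd (fun _ : 'I_4 => 1).
Proof.
apply: (@gdd_intro _ 'I_4 _ id) => [i|].
  by rewrite -[RHS](card1 i) cardsE.
exists [set setT]; split=> [l|x y xy]; first by rewrite inE => /eqP ->; rewrite cardsT card_ord.
rewrite /= xy -[RHS](cards1 [set: 'I_4]); congr #|pred_of_set _|.
by apply/setP=> l; rewrite !inE; case: eqP => [->|//]; rewrite !inE.
Qed.

(** Every point gets weight [m], and every block becomes a transversal design with four groups of
    size [m]. *)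
Lemma gdd_scale (I : finType) (w : I -> nat) (m : nat) :
  orthogonal_array 4 m -> gdd w -> gdd (fun i => m * w i).
Proof.
move=> OA4 gw; pose T := {i : I & 'I_(w i)}; pose c (p : T) := tag p.
have [L [L4 Lc]] : decomposable [rel p q : T | c p != c q].
  apply: eq_decomposable (gw T setT c _) => [x y _|i] /=; first by rewrite !inE.
  by rewrite -[RHS](card_tag_eq w); apply: eq_card => p; rewrite !inE.
have gconst : gdd (fun _ : 'I_4 => m).
  apply: eq_gdd (gdd_td (h := fun _ _ => 1) OA4 _) => [i|_]; last exact: gdd_block4.
  by rewrite sum1_card card_ord.
(* Blocks are indexed by all subsets of [T]; those that are not blocks become empty and contribute
   nothing. *)
pose B (l : {set T}) := if l \in L then l else set0.
apply: eq_gdd (@gdd_wfc T I {set T} c B (fun=> m) _ _) => [i|p q pq|l].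
- rewrite sum_nat_const mulnC -(card_tag_eq w i); congr (_ * _).
  by apply: eq_card => p; rewrite !inE.
- rewrite -(Lc p q pq); congr #|pred_of_set _|; apply/setP=> l; rewrite !inE /B.
  by case: ifP; rewrite ?inE.
- rewrite /B; case: ifP => lL; last first.
    move=> T' A c' cA; apply: decomposable0 => x y _ /=; case: (boolP (x \in A)) => // xA.
    have := cA (c' x); rewrite inE => /eqP; rewrite cards_eq0 => /eqP/setP/(_ x).
    by rewrite !inE xA eqxx.
  have l4 := L4 _ lL.
  have phi_inj : injective (fun i : 'I_4 => enum_val (cast_ord (esym l4) i)).
    by move=> i i' /enum_val_inj /cast_ord_inj.
  apply: (gdd_reindex phi_inj) => [x|]; last first.
    by apply: eq_gdd gconst => i /=; rewrite enum_valP.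
  case: ifP => // xl /negP[]; apply/codomP.
  by exists (cast_ord l4 (enum_rank_in xl x)); rewrite cast_ordK enum_rankK_in.
Qed.

Lemma gdd_support (I : finType) (w : I -> nat) (m : nat) :
    (forall i, w i != 0 -> w i = m) ->
    gdd (fun _ : 'I_#|[set i | w i != 0]| => m) ->
  gdd w.
Proof.
move=> wm; set W := [set i | w i != 0] => gW.
apply: (@gdd_reindex _ _ (@enum_val _ (mem W)) _ enum_val_inj) => [i iW|].
  apply: contraNeq iW => wi; have iW : i \in W by rewrite inE.
  by apply/codomP; exists (enum_rank_in iW i); rewrite enum_rankK_in.
by apply: eq_gdd gW => i /=; have := enum_valP i; rewrite inE => /wm.
Qed.

Lemma sum_truncated (q n m : nat) : n <= q -> \sum_(u < q) (if u < n then m else 0) = m * n.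
Proof.
move=> nq; rewrite -big_mkcond /= -(big_ord_widen q (fun=> m) nq).
by rewrite sum_nat_const card_ord mulnC.
Qed.

(** In group [i] of a transversal design the first [nth 0 s i] points get weight [m] and the others
    weight 0. At least four groups remain complete, so every block keeps between 4 and [K]
    points. *)
Lemma gdd_truncated (m q K : nat) (s : seq nat) :
    (forall j, 4 <= j <= K -> gdd (fun _ : 'I_j => m)) ->
    0 < q -> all (leq^~ q) s -> 4 <= count_mem q s -> size s <= K ->
    orthogonal_array (size s) q ->
  gdd (fun i : 'I_(size s) => m * nth 0 s i).
Proof.
move=> gm q_gt0 /all_nthP sq sq4 sK OAs.
have [->|m_gt0] := posnP m.
  move=> T A c cA; apply: decomposable0 => x y _ /=; case: (boolP (x \in A)) => // xA.
  have := cA (c x); rewrite mul0n => /eqP; rewrite cards_eq0 => /eqP/setP/(_ x).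
  by rewrite !inE xA eqxx.
apply: eq_gdd (gdd_td (h := fun i u => if u < nth 0 s i then m else 0) OAs _) => [i|j].
  by rewrite sum_truncated // sq.
apply: (gdd_support (m := m)) => [i|]; first by case: ifP.
apply: gm; apply/andP; split; last first.
  by apply: leq_trans (max_card _) _; rewrite card_ord.
apply: leq_trans sq4 _; rewrite -sum1_count (big_nth 0) big_mkord sum1_card.
apply: subset_leq_card; apply/subsetP=> i; rewrite !inE unfold_in /= => /eqP ->.
by rewrite ltn_ord -lt0n.
Qed.

(** The list with [w i] copies of each [i] is dealt out to the points of [B] in order. *)
Lemma partition_sizes (T I : finType) (B : {set T}) (w : I -> nat) (i0 : I) :
  \sum_i w i = #|B| -> exists c : T -> I, forall i, #|[set x in B | c x == i]| = w i.
Proof.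
move=> wB; pose s := flatten [seq nseq (w i) i | i <- enum I].
have size_s : size s = size (enum B).
  rewrite size_flatten /shape -map_comp sumnE big_map -cardE -wB big_enum /=.
  by apply: eq_bigr => i _; rewrite size_nseq.
pose c x := nth i0 s (index x (enum B)); exists c => i.
have cs : [seq c x | x <- enum B] = s.
  apply: (@eq_from_nth _ i0) => [|n]; rewrite size_map // => n_lt.
  case: (enum B) (enum_uniq B) n_lt size_s @c => // x0 e e_uniq n_lt size_s c.
  by rewrite (nth_map x0) // /c index_uniq.
have -> : #|[set x in B | c x == i]| = count_mem i [seq c x | x <- enum B].
  rewrite count_map cardE -size_filter; congr size; rewrite /enum_mem -filter_predI.
  by apply: eq_filter => x; rewrite /= !inE andbC.
rewrite cs count_flatten -map_comp sumnE big_map big_enum /= (bigD1 i) //=.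
rewrite count_nseq /= eqxx mul1n big1 ?addn0 // => j ji.
by rewrite count_nseq /= (negPf ji).
Qed.

(** * Filling the groups of a design *)

(** The last two conditions exclude triangles and quadrangles. Points outside [D] are isolated, so
    that graphs on disjoint parts of one type can be united. *)
Record graph5 (T : finType) (D : {set T}) (g : rel T) : Prop := Graph5 {
  graph5_sym : symmetric g;
  graph5_dom : forall x y, g x y -> x \in D;
  graph5_irr : forall x, ~~ g x x;
  graph5_reg : forall x, x \in D -> #|nbhd g x| = 4;
  graph5_C3 : forall x y, g x y -> nbhd g x :&: nbhd g y = set0;
  graph5_C4 : forall x y, x != y -> #|nbhd g x :&: nbhd g y| <= 1
}.

(* For [x != y]: the distance of [x] and [y] is at least 3. *)
Definition far (T : finType) (g : rel T) (x y : T) : bool :=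
  ~~ g x y && (nbhd g x :&: nbhd g y == set0).

Definition code_on (T : finType) (D : {set T}) (g : rel T) (S : {set T}) : Prop :=
  S \subset D /\ {in D &, injective (fun x => nbhd g x :&: S)}.

(* Only the vertices of [A] outside the hole [Y] have neighbours, hence a vertex of
   the hole is far from all other vertices. *)
Definition filled (T : finType) (A Y : {set T}) (g : rel T) (S : {set T}) : Prop :=
  [/\ graph5 (A :\: Y) g, code_on (A :\: Y) g S &
      decomposable [rel x y | [&& x \in A, y \in A, ~~ ((x \in Y) && (y \in Y)) & far g x y]]].

Definition perfect_code (T : finType) (D : {set T}) (g : rel T) (S : {set T}) : Prop :=
  5 * #|S| = 2 * #|D| /\ forall x, x \in D -> nbhd g x :&: S != set0.

Section Graph5.

Variables (T : finType) (D : {set T}) (g : rel T).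
Hypothesis gD : graph5 D g.

Lemma nbhd_out x : x \notin D -> nbhd g x = set0.
Proof.
move=> xD; apply/setP=> y; rewrite !inE; apply/negP => /(graph5_dom gD).
exact/negP.
Qed.

Lemma far_outl x y : x \notin D -> far g x y.
Proof.
move=> xD; rewrite /far nbhd_out // set0I eqxx andbT.
by apply: contra xD => /(graph5_dom gD).
Qed.

Lemma far_sym x y : far g x y = far g y x.
Proof. by rewrite /far (graph5_sym gD) setIC. Qed.

Lemma far_outr x y : y \notin D -> far g x y.
Proof. by rewrite far_sym; apply: far_outl. Qed.

End Graph5.

(** * Disjoint unions of graphs and of their codes *)

Section Union.

Variables (T J : finType) (D : J -> {set T}) (gs : J -> rel T) (Ss : J -> {set T}).
Hypothesis D_disj : forall j k x, x \in D j -> x \in D k -> j = k.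
Hypothesis gsD : forall j, graph5 (D j) (gs j).

Definition union_rel : rel T := [rel x y | [exists j, gs j x y]].

Lemma union_relE j x y : x \in D j -> union_rel x y = gs j x y.
Proof.
move=> xD; apply/existsP/idP => [[k gk]|]; last by exists j.
by rewrite (D_disj xD (graph5_dom (gsD k) gk)).
Qed.

Lemma union_nbhd j x : x \in D j -> nbhd union_rel x = nbhd (gs j) x.
Proof. by move=> xD; apply/setP=> y; rewrite !inE (union_relE _ xD). Qed.

Lemma union_graph5 : graph5 (\bigcup_j D j) union_rel.
Proof.
have sym : symmetric union_rel.
  by move=> x y; apply: eq_existsb => j; apply: graph5_sym (gsD j) _ _.
have dom x y : union_rel x y -> x \in \bigcup_j D j.
  by move=> /existsP[j gj]; apply/bigcupP; exists j; rewrite ?(graph5_dom (gsD j) gj).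
(* Points of different components have no common neighbour. *)
have common x y j : x \in D j -> y \notin D j -> nbhd union_rel x :&: nbhd union_rel y = set0.
  move=> xj yj; apply/setP=> z; rewrite !inE (union_relE _ xj); apply/negP.
  move=> /andP[xz /existsP[k yz]]; move/negP: yj; apply.
  have zj : z \in D j by move: xz; rewrite (graph5_sym (gsD j)) => /(graph5_dom (gsD j)).
  have zk : z \in D k by move: yz; rewrite (graph5_sym (gsD k)) => /(graph5_dom (gsD k)).
  by rewrite (D_disj zj zk) (graph5_dom (gsD k) yz).
split=> //.
- by move=> x; apply/negP=> /existsP[j]; apply/negP; apply: graph5_irr (gsD j) _.
- by move=> x /bigcupP[j _ xj]; rewrite (union_nbhd xj) (graph5_reg (gsD j)).
- move=> x y /existsP[j xy]; have xj := graph5_dom (gsD j) xy.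
  have yj : y \in D j by move: xy; rewrite (graph5_sym (gsD j)) => /(graph5_dom (gsD j)).
  by rewrite (union_nbhd xj) (union_nbhd yj) (graph5_C3 (gsD j)).
- move=> x y xy; have [/existsP[j xj]|] := boolP [exists j, x \in D j]; last first.
    rewrite negb_exists => /forallP xD.
    have -> : nbhd union_rel x = set0; last by rewrite set0I cards0.
    apply/setP=> z; rewrite !inE; apply/existsP=> -[j xz].
    by move/negP: (xD j); apply; apply: graph5_dom (gsD j) _ _ xz.
  have [yj|yj] := boolP (y \in D j); last by rewrite (common _ _ _ xj yj) cards0.
  by rewrite (union_nbhd xj) (union_nbhd yj) (graph5_C4 (gsD j)).
Qed.

(** A common neighbour lies in only one [D j], so a path of length 2 stays inside one component. *)
Lemma union_far x y : far union_rel x y = [forall j, far (gs j) x y].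
Proof.
apply/andP/forallP => [[nxy /eqP cxy] j|farj].
  apply/andP; split; first by apply: contra nxy => gj; apply/existsP; exists j.
  apply/eqP/setP=> z; rewrite !inE; apply/negP=> /andP[xz yz].
  have : z \in nbhd union_rel x :&: nbhd union_rel y.
    by apply/setIP; split; rewrite inE; apply/existsP; exists j.
  by rewrite cxy inE.
split; first by rewrite negb_exists; apply/forallP=> j; case/andP: (farj j).
apply/eqP/setP=> z; rewrite !inE; apply/negP=> /andP[/existsP[j xz] /existsP[k yz]].
have zj : z \in D j by move: xz; rewrite (graph5_sym (gsD j)) => /(graph5_dom (gsD j)).
have zk : z \in D k by move: yz; rewrite (graph5_sym (gsD k)) => /(graph5_dom (gsD k)).
rewrite -(D_disj zj zk) in yz; have /andP[_ /eqP/setP/(_ z)] := farj j.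
by rewrite !inE xz yz.
Qed.

Hypothesis SsD : forall j, Ss j \subset D j.

Lemma union_trace j x :
  x \in D j -> nbhd union_rel x :&: \bigcup_k Ss k = nbhd (gs j) x :&: Ss j.
Proof.
move=> xj; rewrite (union_nbhd xj); apply/setP=> z; rewrite !inE.
case xz: (gs j x z) => //=; have zj : z \in D j.
  by move: xz; rewrite (graph5_sym (gsD j)) => /(graph5_dom (gsD j)).
apply/bigcupP/idP => [[k _ zk]|]; last by exists j.
by rewrite (D_disj zj (subsetP (SsD k) _ zk)).
Qed.

(** Traces from different components lie in disjoint sets, so they can agree only if both are empty;
    empty traces are confined to the component [j0]. *)
Lemma union_code (j0 : J) :
    (forall j, code_on (D j) (gs j) (Ss j)) ->
    (forall j x, j != j0 -> x \in D j -> nbhd (gs j) x :&: Ss j != set0) ->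
  code_on (\bigcup_j D j) union_rel (\bigcup_j Ss j).
Proof.
move=> code ne0; split.
  by apply/bigcupsP=> j _; apply: subset_trans (SsD j) (bigcup_sup j _).
have ne j k x y : x \in D j -> y \in D k -> j != k ->
    nbhd (gs j) x :&: Ss j = nbhd (gs k) y :&: Ss k ->
    nbhd (gs j) x :&: Ss j = set0.
  move=> xj yk jk tr; apply/setP=> z; rewrite [RHS]inE; apply/negP=> zj.
  have /setIP[_ /(subsetP (SsD j)) zDj] := zj.
  move: zj; rewrite tr => /setIP[_ /(subsetP (SsD k))].
  by move=> /(D_disj zDj) /eqP; apply/negP.
move=> x y /bigcupP[j _ xj] /bigcupP[k _ yk] /=.
rewrite (union_trace xj) (union_trace yk) => tr.
have [jk|jk] := eqVneq j k; first by rewrite -jk in yk tr; apply: (code j).2.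
have := ne _ _ _ _ xj yk jk tr; have [jj0|jj0] := eqVneq j j0; last first.
  by move=> /eqP; rewrite (negPf (ne0 _ _ jj0 xj)).
by rewrite tr => /eqP; rewrite (negPf (ne0 _ _ _ yk)) // -jj0 eq_sym.
Qed.

Lemma card_union_code : #|\bigcup_j Ss j| = \sum_j #|Ss j|.
Proof.
rewrite -sum1_card partition_disjoint_bigcup => [|j k jk].
  by apply: eq_bigr => j _; rewrite sum1_card.
rewrite -setI_eq0; apply: contraNT jk => /set0Pn[x /setIP[xj xk]].
by apply/eqP; apply: D_disj (subsetP (SsD j) _ xj) (subsetP (SsD k) _ xk).
Qed.

End Union.

Definition fillable (y m : nat) : Prop :=
  forall (T : finType) (A Y : {set T}), Y \subset A -> #|Y| = y -> #|A :\: Y| = m ->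
  exists g S, filled A Y g S /\ perfect_code (A :\: Y) g S.

(* The bounds say that the code has the size ceil(2 (v - 1) / 5). *)
Definition best_pent (v : nat) : Prop :=
  forall (T : finType) (A : {set T}), #|A| = v ->
  exists g S, filled A set0 g S /\ (2 * v <= 5 * #|S| + 2 /\ 5 * #|S| <= 2 * v + 2).

Lemma graph5_0 (T : finType) : graph5 set0 [rel x y : T | false].
Proof.
have nb0 (x : T) : nbhd [rel x y | false] x = set0 by apply/setP=> y; rewrite !inE.
by split=> // [x|x y _]; rewrite ?inE // !nb0 set0I cards0.
Qed.

Lemma fillable0 (y : nat) : fillable y 0.
Proof.
move=> T A Y YA _ /eqP; rewrite cards_eq0 => /eqP AY.
exists [rel x y | false], set0; rewrite AY; split; last first.
  by split=> [|x]; rewrite ?inE // !cards0.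
rewrite /filled AY; split; first exact: graph5_0.
  by split=> [|x x']; rewrite ?inE // sub0set.
apply: decomposable0 => x x' _ /=; move/eqP: AY; rewrite setD_eq0 => /subsetP AY.
by case: (boolP (x \in A)) => //= /AY ->; case: (boolP (x' \in A)) => //= /AY ->.
Qed.

(** Pairs inside [Y'] are far in [g1], all other pairs are far in [g2]. Hence each pair far in the
    union is covered by exactly one of the two decompositions, unless it lies inside [Y]. *)
Lemma fill_hole (T : finType) (A Y' Y : {set T}) (g1 g2 : rel T) (S1 S2 : {set T}) :
    Y' \subset A -> Y \subset Y' ->
    filled A Y' g1 S1 -> (forall x, x \in A :\: Y' -> nbhd g1 x :&: S1 != set0) ->
    filled Y' Y g2 S2 ->
  exists g S, [/\ filled A Y g S, #|S| = #|S1| + #|S2| &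
    (forall x, x \in Y' :\: Y -> nbhd g2 x :&: S2 != set0) ->
    forall x, x \in A :\: Y -> nbhd g x :&: S != set0].
Proof.
move=> Y'A YY' [g1D c1 dec1] ne1 [g2D c2 dec2].
pose D (b : bool) := if b then A :\: Y' else Y' :\: Y.
pose gs b := if b then g1 else g2; pose Ss b := if b then S1 else S2.
have D_disj j k x : x \in D j -> x \in D k -> j = k.
  by case: j; case: k => //=; rewrite !inE; case: (x \in Y'); rewrite ?andbF.
have gsD j : graph5 (D j) (gs j) by case: j.
have code j : code_on (D j) (gs j) (Ss j) by case: j.
have SsD j : Ss j \subset D j := (code j).1.
have UD : \bigcup_b D b = A :\: Y.
  apply/setP=> x; rewrite big_bool !inE; case xY': (x \in Y') => /=.
    by rewrite (subsetP Y'A) ?andbT.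
  by rewrite andbF orbF; case xY: (x \in Y) => //; rewrite (subsetP YY') in xY'.
exists (union_rel gs), (\bigcup_b Ss b); split.
- split.
  + by rewrite -UD; apply: union_graph5.
  (* The index [false] is the inner filling, the only one that may have an empty trace. *)
  + rewrite -UD; apply: (union_code D_disj gsD SsD (j0 := false)) => //.
    by case=> // x _; apply: ne1.
  + pose e (b : bool) := if b
        then [rel x y | [&& x \in A, y \in A, ~~ ((x \in Y') && (y \in Y')) & far g1 x y]]
        else [rel x y | [&& x \in Y', y \in Y', ~~ ((x \in Y) && (y \in Y)) & far g2 x y]].
    apply: (decomposable_sum (e := e)) => [[]//|x y xy].
    rewrite big_bool /= (union_far D_disj gsD).
    have -> : [forall j, far (gs j) x y] = far g1 x y && far g2 x y.
      apply/forallP/andP => [far12|[f1 f2] []]; rewrite ?f1 ?f2 //.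
      by split; [apply: (far12 true)|apply: (far12 false)].
    have far1 : (x \in Y') && (y \in Y') -> far g1 x y.
      by move=> /andP[xY' _]; apply: (far_outl (gsD true)); rewrite /= !inE xY'.
    have far2 : ~~ ((x \in Y') && (y \in Y')) -> far g2 x y.
      rewrite negb_and => /orP[nY|nY].
        by apply: (far_outl (gsD false)); rewrite /= inE (negPf nY) andbF.
      by apply: (far_outr (gsD false)); rewrite /= inE (negPf nY) andbF.
    have [xyY|xyY] := boolP ((x \in Y') && (y \in Y')).
      have /andP[xY yY] := xyY.
      by rewrite (far1 xyY) xY yY !(subsetP Y'A) // !andbT /= andbF.
    have -> : (x \in Y) && (y \in Y) = false.
      by apply/negP=> /andP[/(subsetP YY') xY /(subsetP YY') yY]; rewrite xY yY in xyY.
    rewrite (far2 xyY) /=; move: xyY.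
    by case: (x \in Y'); case: (y \in Y') => //= _; rewrite ?andbT ?addn0.
- by rewrite (card_union_code D_disj SsD) big_bool.
- move=> ne2 x; rewrite -UD => /bigcupP[j _ xj]; rewrite (union_trace D_disj gsD SsD xj).
  by case: j xj; [apply: ne1|apply: ne2].
Qed.

Lemma subset_of_card (T : finType) (A : {set T}) (n : nat) :
  n <= #|A| -> exists2 B : {set T}, B \subset A & #|B| = n.
Proof.
move=> nA; exists [set x in take n (enum A)].
  by apply/subsetP=> x; rewrite inE => /mem_take; rewrite mem_enum.
rewrite cardsE (card_uniqP _) ?take_uniq ?enum_uniq // size_takel //.
by rewrite -cardE.
Qed.

(* Besides the groups of the design there are [y] additional points; the filled
   group [i] is completed with them, and they end up in the hole together with
   group [i0]. *)
Lemma fillable_gdd (I : finType) (w : I -> nat) (i0 : I) (y : nat) :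
    gdd w -> (forall i, i != i0 -> fillable y (w i)) ->
  fillable (y + w i0) (\sum_(i | i != i0) w i).
Proof.
move=> gw fw T A Y' Y'A cardY' cardA.
have [Y YY' cardY] : exists2 Y : {set T}, Y \subset Y' & #|Y| = y.
  by apply: subset_of_card; rewrite cardY' leq_addr.
(* Group [i0] gets no point outside the hole [Y']: it will consist of the points of [Y' :\: Y]. *)
have [c0 c0w] : exists c0 : T -> I, forall i,
    #|[set x in A :\: Y' | c0 x == i]| = if i != i0 then w i else 0.
  by apply: (partition_sizes i0); rewrite cardA -big_mkcond.
pose c x := if x \in Y' then i0 else c0 x.
pose C i := [set x in A :\: Y | c x == i].
have Y_Y' x : x \in Y -> x \in Y' := subsetP YY' x.
have Y'_A x : x \in Y' -> x \in A := subsetP Y'A x.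
have Ci i : i != i0 -> C i = [set x in A :\: Y' | c0 x == i].
  move=> ii0; apply/setP=> x; rewrite !inE /c; case: ifP => xY' /=.
    by rewrite eq_sym (negPf ii0) andbF.
  by case: (boolP (x \in Y)) => // /Y_Y'; rewrite xY'.
have c0A x : x \in A -> x \notin Y' -> c0 x != i0.
  move=> xA xY'; apply/eqP=> c0x; have := c0w i0; rewrite eqxx /= => /eqP.
  by rewrite cards_eq0 => /eqP/setP/(_ x); rewrite !inE xY' xA c0x eqxx.
have Ci0 : C i0 = Y' :\: Y.
  apply/setP=> x; rewrite !inE /c; case: ifP => xY' /=.
    by rewrite eqxx andbT (Y'_A _ xY') andbT.
  rewrite andbF; apply/negP=> /andP[/andP[_ xA]].
  by apply/negP/c0A; rewrite ?xY'.
have cardC i : #|C i| = w i.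
  have [->|ii0] := eqVneq i i0; last by rewrite Ci // c0w ii0.
  by rewrite Ci0 cardsD (setIidPr YY') cardY cardY' addKn.
(* Group [i0] stays in the hole, so its component is empty. *)
pose D i := if i == i0 then set0 else C i.
pose inner i (g : rel T) := [rel x x' | [&& x \in Y :|: C i, x' \in Y :|: C i,
  ~~ ((x \in Y) && (x' \in Y)) & far g x x']].
have : forall i, exists gS : rel T * {set T},
    [/\ graph5 (D i) gS.1, code_on (D i) gS.1 gS.2, perfect_code (D i) gS.1 gS.2 &
        i != i0 -> decomposable (inner i gS.1)].
  move=> i; rewrite /D; have [_|ii0] := eqVneq i i0.
    exists (([rel x x' | false] : rel T), set0); split=> //=; first exact: graph5_0.
      by split=> [|x x']; rewrite ?inE // sub0set.
    by split=> [|x]; rewrite ?inE // !cards0.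
  have AY : (Y :|: C i) :\: Y = C i.
    by apply/setP=> x; rewrite !inE; case: (x \in Y).
  have [|g [S []]] := fw i ii0 T (Y :|: C i) Y (subsetUl _ _) cardY; first by rewrite AY cardC.
  rewrite /filled AY => -[gC SC dec] perf; exists (g, S); split=> //= _; exact: dec.
move=> /fin_all_exists[gS gSP]; pose gs i := (gS i).1; pose Ss i := (gS i).2.
have gsD i : graph5 (D i) (gs i) by case: (gSP i).
have code i : code_on (D i) (gs i) (Ss i) by case: (gSP i).
have perf i : perfect_code (D i) (gs i) (Ss i) by case: (gSP i).
have dec i : i != i0 -> decomposable (inner i (gs i)) by case: (gSP i).
have SsD i : Ss i \subset D i := (code i).1.
have inD i x : x \in D i = [&& i != i0, x \in A, x \notin Y & c x == i].
  by rewrite /D; case: eqP; rewrite ?inE //= => _; rewrite andbCA andbA.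
have D_disj i j x : x \in D i -> x \in D j -> i = j.
  by rewrite !inD => /and4P[_ _ _ /eqP <-] /and4P[_ _ _ /eqP <-].
have UD : \bigcup_i D i = A :\: Y'.
  apply/setP=> x; rewrite inE; apply/bigcupP/andP => [[i _]|[xY' xA]].
    rewrite inD => /and4P[ii0 -> _ /eqP cx]; split=> //.
    by apply: contra_neqN ii0 => xY'; rewrite -cx /c xY'.
  exists (c x) => //; rewrite inD xA eqxx andbT /=; apply/andP; split; last first.
    by apply: contra xY' => /Y_Y'.
  by rewrite /c (negPf xY') c0A.
exists (union_rel gs), (\bigcup_i Ss i); rewrite -UD; split; last first.
  split=> [|x /bigcupP[i _ xi]]; last first.
    by rewrite (union_trace D_disj gsD SsD xi); case: (perf i) => _; apply.
  rewrite (card_union_code D_disj SsD) (card_union_code D_disj (fun=> subxx _)) !big_distrr.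
  by apply: eq_bigr => i _; case: (perf i).
split; first by rewrite -UD; apply: union_graph5.
  rewrite -UD; apply: (union_code D_disj gsD SsD (j0 := i0)) => // i x _ xi.
  by case: (perf i) => _; apply.
(* The index [i0], which has no filling, is used for the blocks of the design itself. *)
pose e i := if i == i0
  then [rel x x' | [&& x \in A :\: Y, x' \in A :\: Y & c x != c x']] else inner i (gs i).
apply: (decomposable_sum (e := e)) => [i|x x' xx'].
  by rewrite /e; case: eqP => [_|/eqP ii0]; [apply: gw|apply: dec].
have farU : (forall i, x \in D i -> x' \in D i -> far (gs i) x x') -> far (union_rel gs) x x'.
  move=> fari; rewrite (union_far D_disj gsD); apply/forallP=> i.
  have [xi|/(far_outl (gsD i)) //] := boolP (x \in D i).
  have [xi'|/(far_outr (gsD i)) //] := boolP (x' \in D i).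
  exact: fari.
have farUi i : far (union_rel gs) x x' -> far (gs i) x x'.
  by rewrite (union_far D_disj gsD) => /forallP.
have eE i : e i x x' = if i == i0 then [&& x \in A :\: Y, x' \in A :\: Y & c x != c x']
    else [&& x \in Y :|: C i, x' \in Y :|: C i, ~~ ((x \in Y) && (x' \in Y)) & far (gs i) x x'].
  by rewrite /e; case: ifP.
have inYC i z : (z \in Y :|: C i) = (z \in Y) || [&& z \in A, z \notin Y & c z == i].
  by rewrite !inE andbCA andbA.
have cY' z : z \in Y' -> c z = i0 by rewrite /c => ->.
have cY'' z : z \in A -> z \notin Y' -> c z != i0.
  by move=> zA zY'; rewrite /c (negPf zY') c0A.
have [/andP[xA xA']|nA] := boolP ((x \in A) && (x' \in A)); last first.
  rewrite big1 => [|i _] /=; first by rewrite andbA (negPf nA).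
  apply/eqP; rewrite eqb0; apply: contra nA; rewrite eE; case: ifP => _.
    by rewrite !inE => /and3P[/andP[_ ->] /andP[_ ->]].
  rewrite /= !inYC => /and3P[/orP[/Y_Y'/Y'_A ->|/and3P[-> _ _]]];
  by move=> /orP[/Y_Y'/Y'_A ->|/and3P[-> _ _]].
have [/andP[xY' xY'']|nY'] := boolP ((x \in Y') && (x' \in Y')).
  rewrite big1 => [|i _] /=; first by rewrite xY' xY'' !andbF.
  rewrite eE !inYC; case: (eqVneq i i0) => [_|ii0]; first by rewrite !cY' // eqxx !andbF.
  rewrite /= !cY' // ![i0 == i]eq_sym (negPf ii0) !andbF !orbF.
  by case: (x \in Y); case: (x' \in Y).
have Y_A z : z \in Y -> z \in A by move=> /Y_Y'/Y'_A.
(* A pair from two groups is covered by the design, and it is far because no component contains both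
   points. *)
have [/and3P[xY xY'' cxx']|ncross] := boolP [&& x \notin Y, x' \notin Y & c x != c x'].
  rewrite (bigD1 i0) //= eE eqxx !inE xA xA' xY xY'' cxx' nY' /= farU => [|i]; last first.
    by rewrite !inD => /and4P[_ _ _ /eqP xi] /and4P[_ _ _ /eqP xi']; rewrite xi xi' eqxx in cxx'.
  rewrite big1 // => i ii0; rewrite eE (negPf ii0) /= !inYC (negPf xY) (negPf xY'') /=.
  apply/eqP; rewrite eqb0; apply: contra cxx' => /and4P[/andP[_ /eqP ->] /andP[_ /eqP ->]].
  by rewrite eqxx.
(* The pair now lies inside one group or has one point in [Y]; [i] is the only group whose filling
   involves both points. *)
pose i := if x \in Y then c x' else c x.
have YY : ~~ ((x \in Y) && (x' \in Y)).
  by apply: contra nY' => /andP[/Y_Y' -> /Y_Y' ->].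
have ii0 : i != i0.
  rewrite /i; case: ifP => xY; first by apply: cY'' => //; move: nY'; rewrite (Y_Y' _ xY).
  have [xY'|] := boolP (x \in Y'); last exact: cY''.
  move: ncross; rewrite xY /=; have [/Y_Y' xY''|_ /=] := boolP (x' \in Y).
    by rewrite xY' xY'' in nY'.
  by rewrite negbK => /eqP ->; apply: cY'' => //; rewrite xY' in nY'.
have xi : x \in Y :|: C i by rewrite inYC /i; case: (x \in Y); rewrite //= xA eqxx.
have xi' : x' \in Y :|: C i.
  rewrite inYC /i xA' /=; case: (boolP (x' \in Y)) => //= xY''.
  by move: ncross; rewrite xY'' /=; case: (x \in Y); rewrite /= ?eqxx // negbK eq_sym.
rewrite (bigD1 i) //= eE (negPf ii0) /= xi xi' YY xA xA' nY' /=.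
have -> : far (union_rel gs) x x' = far (gs i) x x'.
  apply/idP/idP => [/(farUi i) //|fari]; apply: farU => j.
  rewrite !inD => /and4P[_ _ xY /eqP cx] _; move: fari.
  by rewrite /i (negPf xY) cx.
rewrite big1 ?addn0 // => k ki; rewrite eE; case: (eqVneq k i0) => [_|kk0].
  apply/eqP; rewrite eqb0; apply: contra ncross; rewrite !inE.
  by move=> /and3P[/andP[-> _] /andP[-> _] ->].
apply/eqP; rewrite eqb0; apply: contra ki; rewrite /= !inYC /i => /and4P[].
case: (x \in Y) YY => /= YY; last by move=> /andP[_ /eqP ->].
by rewrite (negPf YY) /= => _ /andP[_ /eqP ->].
Qed.

(** The outer [m] points are filled around the enlarged hole of size [y + w], whose new part is then
    filled around the old hole. *)
Lemma fillable_trans (y w m : nat) :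
  fillable (y + w) m -> fillable y w -> fillable y (m + w).
Proof.
move=> fm fw T A Y YA cardY cardAY.
have [B BAY cardB] : exists2 B : {set T}, B \subset A :\: Y & #|B| = w.
  by apply: subset_of_card; rewrite cardAY leq_addl.
have BA : B \subset A := subset_trans BAY (subsetDl _ _).
have BY : [disjoint Y & B].
  rewrite -setI_eq0; apply/eqP/setP=> x; rewrite !inE; apply/negP=> /andP[xY /(subsetP BAY)].
  by rewrite inE xY.
have YA' : Y :|: B \subset A by rewrite subUset YA.
have cardYB : #|Y :|: B| = y + w by rewrite cardsU disjoint_setI0 // cards0 subn0 cardY cardB.
have YBY : (Y :|: B) :\: Y = B.
  by rewrite setDUl setDv set0U; apply/setDidPl; rewrite disjoint_sym.
have cardAYB : #|A :\: (Y :|: B)| = m.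
  by rewrite -setDDl cardsD (setIidPr BAY) cardAY cardB addnK.
have [g1 [S1 [f1 [cS1 ne1]]]] := fm T A _ YA' cardYB cardAYB.
have [|g2 [S2 [f2 [cS2 ne2]]]] := fw T (Y :|: B) Y (subsetUl _ _) cardY; first by rewrite YBY.
have [g [S [f cS ne]]] := fill_hole YA' (subsetUl Y B) f1 ne1 f2.
exists g, S; split=> //; split; last exact: ne.
by rewrite cS mulnDr cS1 cS2 YBY cardAYB cardB cardAY mulnDr.
Qed.

Lemma best_pent_fill (v m : nat) : fillable v m -> best_pent v -> best_pent (m + v).
Proof.
move=> fm bv T A cardA.
have [Y YA cardY] : exists2 Y : {set T}, Y \subset A & #|Y| = v.
  by apply: subset_of_card; rewrite cardA leq_addl.
have cardAY : #|A :\: Y| = m by rewrite cardsD (setIidPr YA) cardA cardY addnK.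
have [g1 [S1 [f1 [cS1 ne1]]]] := fm T A Y YA cardY cardAY.
have [g2 [S2 [f2 cS2]]] := bv T Y cardY.
have [g [S [f cS _]]] := fill_hole YA (sub0set Y) f1 ne1 f2.
by exists g, S; split=> //; rewrite cardAY in cS1; lia.
Qed.

Lemma best_pent0 : best_pent 0.
Proof.
move=> T A /eqP; rewrite cards_eq0 => /eqP ->.
have [|g [S [f [cS _]]]] := @fillable0 0 T set0 set0 (sub0set _) (cards0 _).
  by rewrite set0D cards0.
by exists g, S; split=> //; rewrite set0D cards0 in cS; lia.
Qed.

Lemma best_pent_perfect (v : nat) : fillable 0 v -> best_pent v.
Proof. by move=> fv; rewrite -[v]addn0; apply: best_pent_fill best_pent0. Qed.

(** This is [fillable_gdd] for sizes given by a list: the group of index 0 merges with the [y]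
    additional points into the new hole. *)
Lemma fillable_step (y m n0 : nat) (s : seq nat) :
    gdd (fun i : 'I_(size s).+1 => m * nth 0 (n0 :: s) i) ->
    (forall n, n \in s -> fillable y (m * n)) ->
  fillable (y + m * n0) (m * sumn s).
Proof.
move=> gs fs; have -> : m * sumn s = \sum_(i < (size s).+1 | i != ord0) m * nth 0 (n0 :: s) i.
  rewrite big_mkcond big_ord_recl /= add0n sumnE (big_nth 0) big_mkord big_distrr.
  exact: eq_bigr.
apply: (fillable_gdd (i0 := ord0) gs) => i; case: (unliftP ord0 i) => [j ->|-> /eqP //] _.
by apply: fs; rewrite lift0 /= mem_nth.
Qed.

(** With denominators cleared, the two bounds are $2(v-1) \le 5s < 2(v-1) + 5$. *)
Lemma code_size_ceil (v s : nat) : 2 * v <= 5 * s + 2 -> 5 * s <= 2 * v + 2 ->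
  (s%:Z = Num.ceil (2 * (v%:R - 1) / (4%:R + 1) : rat))%R.
Proof.
move=> le1 le2.
have {}le1 : (2 * v%:R <= 5 * s%:R + 2 :> rat)%R by rewrite -!natrM -natrD ler_nat.
have {}le2 : (5 * s%:R <= 2 * v%:R + 2 :> rat)%R by rewrite -!natrM -natrD ler_nat.
apply: le_anti; rewrite ceil_le_int -ltzD1 -ltrBlDr ceil_gt_int !rmorphB /= ?intrM ?natz.
have -> : (4%:R + 1 = 5 :> rat)%R by [].
rewrite -pmulrn ler_pdivrMr // ltr_pdivlMr //; apply/andP; split; lra.
Qed.

(** * From filled graphs to pentagonal geometries *)

Section FromBestPent.

Variables (r : nat) (T : finType) (g : rel T) (S : {set T}).
Hypothesis cardT : #|T| = 3 * r + 5.
Hypothesis filledT : filled setT set0 g S.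
Hypothesis code_size : 2 * #|T| <= 5 * #|S| + 2 /\ 5 * #|S| <= 2 * #|T| + 2.

(** The lines are the blocks and the neighbourhoods of the points. A pair at distance at least 3 is
    on one block, a pair at distance 2 in one neighbourhood and an adjacent pair on no line, so the
    deficiency graph is [g]. *)
Lemma pentagonal_of_filled : exists L : {set {set T}},
  [/\ pentagonal_geometry L 4 r, girth_at_least (deficiency L) 5
    & best_possible_code (deficiency L) 4 S].
Proof.
case: filledT; rewrite setD0 => g5 [_ codeS] [L1 [L14 L1far]].
have reg x : #|nbhd g x| = 4 by rewrite (graph5_reg g5) ?inE.
have L1farE x y : x != y -> #|[set l in L1 | (x \in l) && (y \in l)]| = far g x y.
  by move=> xy; rewrite L1far //= !inE.
have g_sym := graph5_sym g5.
pose L := L1 :|: [set nbhd g x | x in T].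
have nbL z : nbhd g z \in L by rewrite inE orbC imset_f ?inE.
have L1_far x y l : x != y -> l \in L1 -> x \in l -> y \in l -> far g x y.
  move=> xy lL xl yl; have := L1farE x y xy; case: (far g x y) => // /eqP.
  by rewrite cards_eq0 => /eqP/setP/(_ l); rewrite !inE lL xl yl.
have nb_nfar x y z : x \in nbhd g z -> y \in nbhd g z -> far g x y = false.
  rewrite !inE ![g z _]g_sym => xz yz; apply/negP=> /andP[_ /eqP/setP/(_ z)].
  by rewrite !inE xz yz.
have LP l : l \in L -> l \in L1 \/ exists z, l = nbhd g z.
  by rewrite inE => /orP[|/imsetP[z _ ->]]; [left|right; exists z].
have pls : partial_linear_space L.
  move=> x y xy l m /LP lL /LP mL xl yl xm ym.
  case: lL => [lL1|[z zE]]; case: mL => [mL1|[z' zE']].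
  - have := L1farE x y xy; rewrite (L1_far x y l) // => /eqP/cards1P[l0 /setP l0E].
    have := l0E l; have := l0E m; rewrite !inE lL1 mL1 xl yl xm ym /=.
    by move=> /esym/eqP -> /esym/eqP ->.
  - by have := L1_far x y l xy lL1 xl yl; rewrite (nb_nfar x y z') -?zE'.
  - by have := L1_far x y m xy mL1 xm ym; rewrite (nb_nfar x y z) -?zE.
  - have [zz'|zz'] := eqVneq z z'; first by rewrite zE zE' zz'.
    rewrite zE zE' in xl yl xm ym *.
    have sub : [set x; y] \subset nbhd g z :&: nbhd g z'.
      by apply/subsetP=> u /set2P[] ->; rewrite inE ?xl ?xm ?yl ?ym.
    have := leq_trans (subset_leq_card sub) (graph5_C4 g5 zz').
    by rewrite cards2 xy.
have defE x y : deficiency L x y = g x y.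
  rewrite /deficiency /=; apply/negP/idP => [ncol|gxy /existsP[l /and3P[/LP[lL1|[z ->]] xl yl]]].
  - apply/negPn/negP=> ngxy; apply: ncol; apply/existsP.
    have [<-|xy] := eqVneq x y.
      have /card_gt0P[z] : 0 < #|nbhd g x| by rewrite reg.
      by rewrite inE => xz; exists (nbhd g z); rewrite nbL !inE g_sym xz.
    have [fxy|] := boolP (far g x y).
      have : 0 < #|[set l in L1 | (x \in l) && (y \in l)]| by rewrite L1farE // fxy.
      move=> /card_gt0P[l]; rewrite inE => /andP[lL1 xyl]; exists l.
      by rewrite xyl andbT inE lL1.
    rewrite /far ngxy /= => /set0Pn[z]; rewrite !inE => /andP[xz yz].
    by exists (nbhd g z); rewrite nbL !inE ![g z _]g_sym xz yz.
  - have xy : x != y by apply: contraTneq gxy => ->; apply: graph5_irr g5 _.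
    by have := L1_far x y l xy lL1 xl yl; rewrite /far gxy.
  - have := graph5_C3 g5 gxy => /setP/(_ z); move: xl yl; rewrite !inE.
    by rewrite ![g z _]g_sym => -> ->.
have colE x y : collinear L x y = ~~ g x y by rewrite -defE negbK.
have g_irr x : g x x = false by apply/negbTE/(graph5_irr g5).
have L4 l : l \in L -> #|l| = 4 by move=> /LP[/L14|[z ->]] //; apply: reg.
(* Double counting: apart from [x] and its 4 neighbours, each of the [3 * r] other points is on one
   line with [x], and each line through [x] contains 3 of them. *)
have deg x : #|[set l in L | x \in l]| = r.
  pose U := [set y | (y != x) && ~~ g x y].
  have cardU : #|U| = 3 * r.
    have UE : ~: U = x |: nbhd g x by apply/setP=> y; rewrite !inE negb_and !negbK.
    have := cardsC U; rewrite UE cardsU1 !inE g_irr reg cardT /=; lia.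
  suff : 3 * #|[set l in L | x \in l]| = 3 * r by lia.
  have one y : y \in U -> \sum_(l in [set l in L | x \in l]) (y \in l : nat) = 1.
    rewrite inE => /andP[yx ngxy].
    have : collinear L x y by rewrite colE.
    move=> /existsP[l /and3P[lL xl yl]].
    rewrite (bigD1 l) /=; last by rewrite inE lL.
    rewrite yl big1 // => m; rewrite inE => /andP[/andP[mL xm] ml].
    apply/eqP; rewrite eqb0; apply: contra ml => ym; apply/eqP.
    by apply: pls xm ym xl yl => //; rewrite eq_sym.
  transitivity (\sum_(y in U) \sum_(l in [set l in L | x \in l]) (y \in l : nat)).
    rewrite exchange_big mulnC -sum_nat_const; apply: eq_bigr => l; rewrite inE => /andP[lL xl].
    have := L4 l lL; rewrite (cardsD1 x) xl => -[<-].
    rewrite -sum1_card big_mkcond [RHS]big_mkcond /=.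
    apply: eq_bigr => y _; rewrite !inE.
    have [->|yx] /= := eqVneq y x; first by [].
    case yl: (y \in l); last by case: ifP.
    suff -> : g x y = false by [].
    by apply/negbTE; rewrite -colE; apply/existsP; exists l; rewrite lL xl.
  by rewrite (eq_bigr _ one) sum1_card cardU.
exists L; split.
- split=> //; first by rewrite cardT addnC.
  move=> x; have -> : [set y | ~~ collinear L x y] = nbhd g x; last exact: nbL.
  by apply/setP=> y; rewrite !inE colE negbK.
- move=> c; rewrite /ucycle (eq_cycle defE).
  case: c => [|a [|b [|c [|d [|? ?]]]]] //= cyc _; exfalso.
    case/andP: cyc => /and4P[ab bc ca _] _.
    have /setP/(_ c) := graph5_C3 g5 ab; rewrite !inE.
    by rewrite [g a c]g_sym ca bc.
  case/andP: cyc => /and5P[ab bc cd da _].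
  rewrite !inE !negb_or => /and4P[/and3P[_ ac _] /andP[_ bd] _ _].
  have sub : [set b; d] \subset nbhd g a :&: nbhd g c.
    by apply/subsetP=> u /set2P[] ->; rewrite !inE ?ab ?[g a d]g_sym ?da ?cd // g_sym bc.
  by have := leq_trans (subset_leq_card sub) (graph5_C4 g5 ac); rewrite cards2 bd.
- have nbE x : nbhd (deficiency L) x = nbhd g x by apply/setP=> y; rewrite !inE defE.
  split; first by move=> x; rewrite nbE.
    by move=> x y /=; rewrite !nbE; apply: codeS; rewrite inE.
  by apply: code_size_ceil; case: code_size.
Qed.

End FromBestPent.

Lemma pentagonal_of_best_pent (r : nat) : best_pent (3 * r + 5) ->
  exists (T : finType) (L : {set {set T}}),
    [/\ pentagonal_geometry L 4 r, girth_at_least (deficiency L) 5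
      & exists S : {set T}, best_possible_code (deficiency L) 4 S].
Proof.
move=> bp; have cardT : #|'I_(3 * r + 5)| = 3 * r + 5 by rewrite card_ord.
have [g [S [fT codeT]]] := bp _ [set: 'I_(3 * r + 5)] (etrans (cardsT _) cardT).
have [|L [pg gi bc]] := pentagonal_of_filled cardT fT; first by rewrite cardT.
by exists 'I_(3 * r + 5), L; split=> //; exists S.
Qed.

(** * Cyclic designs checked by computation *)

(** A block contains 12 ordered pairs. If every edge is covered and the blocks contain no more pairs
    than there are edges, then no edge is covered twice and no other pair is covered. *)
Lemma decomposable_count (T : finType) (e : rel T) (L : {set {set T}}) :
    (forall l, l \in L -> #|l| = 4) ->
    (forall x y, x != y -> e x y -> exists2 l, l \in L & (x \in l) && (y \in l)) ->
    12 * #|L| <= \sum_x \sum_y ((x != y) && e x y) ->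
  decomposable e.
Proof.
move=> L4 cov le; exists L; split=> //.
pose N x y := #|[set l in L | (x \in l) && (y \in l)]|.
pose F (p : T * T) := (p.1 != p.2) * N p.1 p.2.
pose E (p : T * T) : nat := (p.1 != p.2) && e p.1 p.2.
have EF p : E p <= F p ?= iff (E p == F p).
  apply/leqifP; case: eqP => // /eqP neq; rewrite ltn_neqAle neq /E /F.
  case: (boolP (p.1 != p.2)) => //= xy; case exy: (e p.1 p.2) => //=.
  have [l lL xyl] := cov _ _ xy exy; rewrite mul1n card_gt0.
  by apply/set0Pn; exists l; rewrite inE lL.
have sumF : \sum_p F p = 12 * #|L|.
  have -> : \sum_p F p = \sum_p \sum_(l in L) ((p.1 != p.2) && ((p.1 \in l) && (p.2 \in l)) : nat).
    apply: eq_bigr => p _; rewrite /F /N -sum1_card big_distrr /= big_mkcond [RHS]big_mkcond /=.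
    apply: eq_bigr => l _; rewrite inE; case: (l \in L) => //=.
    by case: (_ != _); case: (_ && _).
  rewrite exchange_big mulnC -sum_nat_const; apply: eq_bigr => l lL.
  rewrite -(pair_big xpredT xpredT (fun x y => (x != y) && ((x \in l) && (y \in l)) : nat)) /=.
  rewrite (bigID (mem l)) /= [X in _ + X]big1 => [|x xl]; last first.
    have {}xl : (x \in l) = false := negPf xl.
    by rewrite big1 // => y _; rewrite xl andbF.
  rewrite addn0 -[12]/(4 * 3) -(L4 l lL) -sum_nat_const; apply: eq_bigr => x xl.
  have := L4 l lL; rewrite (cardsD1 x) xl => -[<-]; rewrite -sum1_card [RHS]big_mkcond /=.
  by apply: eq_bigr => y _; rewrite !inE eq_sym /=; case: (_ && _).
have sumE : \sum_p E p = \sum_x \sum_y ((x != y) && e x y).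
  by rewrite [RHS](pair_big xpredT xpredT (fun x y => (x != y) && e x y : nat)).
(* Since [E] is bounded by [F] pointwise, equal sums force equality everywhere. *)
have [leEF eqEF] := @leqif_sum _ xpredT (fun p => E p == F p) E F (fun p _ => EF p).
have : \sum_p E p == \sum_p F p by rewrite eqn_leq leEF /= sumE sumF.
rewrite eqEF => /forallP eqF x y xy; have := eqF (x, y).
by rewrite implyTb /E /F /= xy mul1n => /eqP.
Qed.

(* The permutation of [0, sumn lens) whose cycles are the consecutive intervals
   of lengths [lens]. *)
Fixpoint shift (lens : seq nat) (x : nat) : nat :=
  if lens is l :: lens' then
    if x < l then (if x.+1 < l then x.+1 else 0) else l + shift lens' (x - l)
  else x.

Fixpoint starts (lens : seq nat) : seq nat :=
  if lens is l :: lens' then 0 :: [seq l + s | s <- starts lens'] else [::].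

Lemma shift_lt lens x : x < sumn lens -> shift lens x < sumn lens.
Proof.
elim: lens x => //= l lens IH x xlt; case: (ltnP x l) => xl; first by case: (ltnP x.+1 l); lia.
by rewrite ltn_add2l IH //; lia.
Qed.

Lemma shift_inj lens x y :
  x < sumn lens -> y < sumn lens -> shift lens x = shift lens y -> x = y.
Proof.
elim: lens x y => //= l lens IH x y xlt ylt.
case: (ltnP x l) => xl; case: (ltnP y l) => yl.
- by case: (ltnP x.+1 l); case: (ltnP y.+1 l); lia.
- by case: (ltnP x.+1 l); lia.
- by case: (ltnP y.+1 l); lia.
- move/addnI/IH => /(_ _)/(_ _); lia.
Qed.

Lemma iter_shift_cons l lens i x :
  iter i (shift (l :: lens)) (l + x) = l + iter i (shift lens) x.
Proof.
elim: i => //= i ->; rewrite ltnNge leq_addr /=; congr (_ + shift _ _); lia.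
Qed.

Lemma shift_orbit lens x : all (ltn 0) lens -> x < sumn lens ->
  exists2 s, s \in starts lens & exists i, x = iter i (shift lens) s.
Proof.
elim: lens x => //= l lens IH x /andP[l_gt0 lens_gt0] xlt.
case: (ltnP x l) => xl.
  exists 0; first by rewrite inE.
  exists x; elim: x xl {xlt} => //= x IHx xl; rewrite -IHx; last lia.
  by rewrite ltnW // xl.
have [|s sin [i xE]] := IH (x - l) lens_gt0; first lia.
exists (l + s); first by rewrite inE; apply/orP; right; apply: map_f.
by exists i; rewrite iter_shift_cons -xE; lia.
Qed.

Definition developed (lens : seq nat) (bs : seq (seq nat * nat)) : seq (seq nat) :=
  flatten [seq traject (map (shift lens)) b.1 b.2 | b <- bs].

(* [bs] lists base blocks together with the lengths of their orbits, and [nr]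
   gives for every point the points with which it must not share a block; it
   suffices to check one point in each cycle, and a count excludes repetitions. *)
Definition cyclic_check (lens : seq nat) (bs : seq (seq nat * nat)) (nr : seq (seq nat)) :
    bool :=
  let v := sumn lens in
  let devs := developed lens bs in
  [&& all (ltn 0) lens,
      all (fun x => let R := nth [::] nr x in let R' := nth [::] nr (shift lens x) in
        [&& x \in R, uniq R, all (gtn v) R & all (fun y => shift lens y \in R') R]) (iota 0 v),
      all (fun b => [&& size b.1 == 4, uniq b.1, all (gtn v) b.1, 0 < b.2 &
        all (mem b.1) (iter b.2 (map (shift lens)) b.1)]) bs,
      12 * sumn (unzip2 bs) <= sumn [seq v - size (nth [::] nr x) | x <- iota 0 v] &
      all (fun s => let R := nth [::] nr s in let near := flatten [seq B <- devs | s \in B] in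
        all (fun y => (y \in R) || (y \in near)) (iota 0 v)) (starts lens)].

Section CyclicDesign.

Variables (lens : seq nat) (bs : seq (seq nat * nat)) (nr : seq (seq nat)).
Let v := sumn lens.

Lemma card_ord_seq (R : seq nat) :
  uniq R -> all (gtn v) R -> #|[set x : 'I_v | val x \in R]| = size R.
Proof.
move=> R_uniq /allP Rv; rewrite cardE -(size_map val); apply: perm_size.
apply: uniq_perm => //; first by rewrite map_inj_uniq ?enum_uniq //; apply: val_inj.
move=> x; apply/mapP/idP => [[y + ->]|xR]; first by rewrite mem_enum inE.
by exists (Ordinal (Rv x xR : x < v)) => //; rewrite mem_enum inE.
Qed.

(** The shift preserves both the forbidden pairs and the blocks, so coverage of a pair can be tested
    after moving its first point to the start of a cycle. *)
Lemma decomposable_cyclic :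
  cyclic_check lens bs nr -> decomposable [rel x y : 'I_v | val y \notin nth [::] nr x].
Proof.
case/and5P=> lens_gt0 /allP nrP /allP bsP count /allP covP.
have {}nrP x : x < v -> [/\ x \in nth [::] nr x, uniq (nth [::] nr x),
    all (gtn v) (nth [::] nr x) &
    forall y, y \in nth [::] nr x -> shift lens y \in nth [::] nr (shift lens x)].
  by move=> xv; have := nrP x; rewrite mem_iota => /(_ xv) /and4P[? ? ? /allP].
pose sh := shift lens; pose devs := developed lens bs.
pose good (B : seq nat) := [&& size B == 4, uniq B & all (gtn v) B].
have good_sh B : good B -> good (map sh B).
  move=> /and3P[B4 B_uniq /allP Bv]; apply/and3P; split; first by rewrite size_map.
    by rewrite map_inj_in_uniq // => x y /Bv xv /Bv yv; apply: shift_inj.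
  by apply/allP=> _ /mapP[x /Bv xv ->]; apply: shift_lt.
have good_iter B i : good B -> good (iter i (map sh) B).
  by move=> gB; elim: i => //= i; apply: good_sh.
have bs_good b : b \in bs -> good b.1.
  by move=> /bsP/and5P[? ? ? _ _]; apply/and3P.
have devsP B : B \in devs -> exists b i, [/\ b \in bs, i < b.2 & B = iter i (map sh) b.1].
  move=> /flattenP[s /mapP[b bbs ->]] /trajectP[i ib ->]; by exists b, i.
have in_devs b i : b \in bs -> i < b.2 -> iter i (map sh) b.1 \in devs.
  move=> bbs ib; apply/flattenP; exists (traject (map sh) b.1 b.2).
    by apply/mapP; exists b.
  by apply/trajectP; exists i.
have devs_good B : B \in devs -> good B.
  by move=> /devsP[b [i [bbs _ ->]]]; apply/good_iter/bs_good.
(* The shift of the last block of an orbit is contained in the base block; hence the family is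
   closed under the shift up to the order of points. *)
have devs_sh B : B \in devs -> exists2 B', B' \in devs & {subset map sh B <= B'}.
  move=> /devsP[b [i [bbs ib ->]]].
  have [ib'|bi] := ltnP i.+1 b.2; first by exists (iter i.+1 (map sh) b.1); rewrite ?in_devs.
  have iE : i.+1 = b.2 by lia.
  have /and5P[_ _ _ b_gt0 /allP sub] := bsP b bbs.
  exists b.1; first exact: (in_devs b 0).
  by move=> x; rewrite -[map sh _]/(iter i.+1 (map sh) b.1) iE; apply: sub.
pose L := [set l in [seq [set x : 'I_v | val x \in B] | B <- devs]].
apply: (@decomposable_count _ _ L) => [l|x y _ /=|].
- rewrite inE => /mapP[B /devs_good/and3P[/eqP <- B_uniq Bv] ->].
  exact: card_ord_seq.
- move=> xy.
  suff [B Bdevs [xB yB]] : exists2 B, B \in devs & val x \in B /\ val y \in B.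
    exists [set x : 'I_v | val x \in B]; last by rewrite !inE xB yB.
    by rewrite inE; apply: map_f.
  pose sigma (z : 'I_v) : 'I_v := Ordinal (shift_lt (ltn_ord z)).
  have sigma_inj : injective sigma.
    by move=> z z' /(congr1 val) /shift_inj zz'; apply/val_inj/zz'.
  have [s s_start [i xE]] := shift_orbit lens_gt0 (ltn_ord x).
  have iter_sigma j z : val (iter j sigma z) = iter j sh z by elim: j => //= j ->.
  have iter_inj : injective (iter i sigma).
    by elim: i {xE} => //= j IH z z' /sigma_inj/IH.
  (* [tau] undoes the [i] shifts leading from [s] to [x], so the pair of [s] and [y'] is shifted to
     that of [x] and [y]. *)
  have [tau _ tauK] := injF_bij iter_inj.
  pose y' := tau y; have yE : val y = iter i sh y' by rewrite -iter_sigma tauK.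
  have sv : s < v.
    have : forall l s', s' \in starts l -> all (ltn 0) l -> s' < sumn l.
      elim=> //= l ls IH s'; rewrite inE => /orP[/eqP ->|/mapP[t tin ->]] /andP[l_gt0 ls_gt0].
        by rewrite addn_gt0 l_gt0.
      by rewrite ltn_add2l IH.
    exact.
  have nr_iter j z w : z < v -> w \in nth [::] nr z ->
      iter j sh z < v /\ iter j sh w \in nth [::] nr (iter j sh z).
    move=> zv wz; elim: j => //= j [jv jw]; split; first exact: shift_lt.
    by have [_ _ _] := nrP _ jv; apply.
  have := covP s s_start => /allP/(_ (val y')); rewrite mem_iota ltn_ord => /(_ isT)/orP[ys|].
    by have [_] := nr_iter i _ _ sv ys; rewrite -yE -xE (negPf xy).
  move=> /flattenP[B]; rewrite mem_filter => /andP[sB Bdevs] yB.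
  have [B' B'devs B'P] : exists2 B', B' \in devs & forall z, z \in B -> iter i sh z \in B'.
    elim: i {xE iter_inj tau tauK y' yE yB} => [|j [B' /devs_sh[B'' B''devs sub] B'P]].
      by exists B.
    by exists B'' => // z /B'P zB'; apply: sub; rewrite iterS map_f.
  by exists B' => //; split; [have := B'P _ sB; rewrite -xE|have := B'P _ yB; rewrite -yE].
- have -> : \sum_x \sum_(y : 'I_v) ((x != y) && (val y \notin nth [::] nr (val x))) =
            sumn [seq v - size (nth [::] nr x) | x <- iota 0 v].
    rewrite sumnE big_map -[iota 0 v](congr1 (iota 0) (subn0 v)) big_mkord.
    apply: eq_bigr => x _; have [xx nr_uniq nr_v _] := nrP _ (ltn_ord x).
    rewrite -(card_ord_seq nr_uniq nr_v) -[X in X - _](card_ord v) -cardsT -cardsDS ?subsetT //.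
    rewrite -sum1_card [RHS]big_mkcond; apply: eq_bigr => y _; rewrite !inE andbT.
    case: (boolP (val y \in _)) => [|ny]; rewrite ?andbF //= andbT.
    by have -> // : x != y; apply: contraNneq ny => <-.
  apply: leq_trans count; rewrite leq_mul2l /=.
  apply: leq_trans (_ : size devs <= _).
    have -> : L = [set l | l \in [seq [set x : 'I_v | val x \in B] | B <- devs]] by [].
    by rewrite cardsE; apply: leq_trans (card_size _) _; rewrite size_map.
  rewrite /devs /developed size_flatten /shape -map_comp /unzip2.
  by rewrite (eq_map (g := snd)) // => b; rewrite /= size_traject.
Qed.

End CyclicDesign.

(** * Cyclic group divisible designs *)

Lemma gdd_comp (I I' : finType) (phi : I' -> I) (w : I -> nat) :
    injective phi -> (forall i, i \notin codom phi -> w i = 0) ->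
  gdd w -> gdd (w \o phi).
Proof.
move=> phi_inj w0 gw T A c cA.
apply: eq_decomposable (gw T A (phi \o c) _) => [x y _|i] /=.
  by rewrite (inj_eq phi_inj).
have [/codomP[i' ->]|/[dup] ni /w0 ->] := boolP (i \in codom phi).
  by rewrite -[RHS]cA; congr #|pred_of_set _|; apply/setP=> x; rewrite !inE (inj_eq phi_inj).
apply/eqP; rewrite cards_eq0; apply/eqP/setP=> x; rewrite !inE; apply/negP=> /andP[_ /eqP iE].
by move/negP: ni; apply; rewrite -iE; apply: codom_f.
Qed.

(** This is the type $a^k m^1$, with the exceptional group last; [m = 0] gives the type $a^k$. *)
Definition wt (k a m : nat) (i : 'I_k.+1) : nat := if i < k then a else m.

Lemma gdd_const_wt (k a : nat) : gdd (wt (k := k) a 0) <-> gdd (fun _ : 'I_k => a).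
Proof.
have wtE : (fun _ : 'I_k => a) =1 wt (k := k) a 0 \o lift ord_max.
  by move=> i; rewrite /wt /comp lift_max ltn_ord.
have wt0 i : i \notin codom (lift (@ord_max k)) -> wt a 0 i = 0.
  case: (unliftP ord_max i) => [j ->|-> _]; first by rewrite codom_f.
  by rewrite /wt ltnn.
split=> gw; first exact: eq_gdd (fsym wtE) (gdd_comp (@lift_inj _ _) wt0 gw).
by apply: (gdd_reindex (@lift_inj _ ord_max) wt0); apply: eq_gdd wtE gw.
Qed.

(* Points [0, c w) form [c] cycles of length [w], each of them the union of [q]
   groups; the other points, in cycles of lengths [li], form one more group. *)
Section CyclicGdd.

Variables (w q c : nat) (li : seq nat) (bs : seq (seq nat * nat)).

Let lens := nseq c w ++ li.

(** For [q] dividing [w], the groups in a cycle are the residue classes modulo [q], which the shift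
    permutes. *)
Definition group_index : seq nat :=
  [seq x %/ w * q + x %% q | x <- iota 0 (c * w)] ++ nseq (sumn li) (c * q).

Definition cyclic_gdd_check : bool :=
  let v := sumn lens in let g := group_index in
  [&& size g == v, all (geq (c * q)) g,
      all (fun i => count_mem i g == if i < c * q then w %/ q else sumn li) (iota 0 (c * q).+1) &
      cyclic_check lens bs [seq [seq y <- iota 0 v | nth 0 g y == k] | k <- g]].

Lemma cyclic_gdd : cyclic_gdd_check -> gdd (wt (k := c * q) (w %/ q) (sumn li)).
Proof.
case/and4P=> /eqP size_g /allP g_le /allP g_count /decomposable_cyclic dec.
set v := sumn lens in size_g dec.
have nth_le (x : 'I_v) : nth 0 group_index x < (c * q).+1.
  by apply: g_le; rewrite mem_nth // size_g ltn_ord.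
apply: (@gdd_intro _ 'I_v _ (fun x => inord (nth 0 group_index x))) => [i|].
  rewrite /wt -(eqP (g_count i _)); last by rewrite mem_iota add0n /= ltn_ord.
  rewrite -sum1_count (big_nth 0) big_mkord -sum1_card size_g.
  by apply: eq_bigl => x; rewrite inE -[inord _ == _]val_eqE /= inordK ?nth_le.
apply: eq_decomposable dec => x y _ /=.
rewrite (nth_map 0) ?size_g // mem_filter mem_iota ltn_ord andbT.
by rewrite -[inord _ == inord _]val_eqE /= !inordK ?nth_le // andbT eq_sym.
Qed.

End CyclicGdd.

(** * Transport of a filled graph to another point set *)

Section Transport.

Variables (T' T : finType) (A : {set T}) (f : T' -> T) (g : rel T') (S : {set T'}).
Hypothesis f_inj : injective f.
Hypothesis fA : f @: setT = A.
Hypothesis g5 : graph5 setT g.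
Hypothesis codeS : {in setT &, injective (fun x => nbhd g x :&: S)}.

Definition image_rel : rel T :=
  [rel u u' | [exists x, exists y, [&& f x == u, f y == u' & g x y]]].

Lemma image_relE x y : image_rel (f x) (f y) = g x y.
Proof.
apply/existsP/idP => [[x' /existsP[y' /and3P[/eqP/f_inj -> /eqP/f_inj -> //]]]|gxy].
by exists x; apply/existsP; exists y; rewrite !eqxx.
Qed.

Lemma image_relP u u' : image_rel u u' -> exists x y, [/\ u = f x, u' = f y & g x y].
Proof. by move=> /existsP[x /existsP[y /and3P[/eqP <- /eqP <- gxy]]]; exists x, y. Qed.

Lemma nbhd_image x : nbhd image_rel (f x) = f @: nbhd g x.
Proof.
apply/setP=> u; rewrite inE.
apply/idP/imsetP => [/image_relP[x' [y [/f_inj <- -> xy]]]|[y + ->]].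
  by exists y; rewrite ?inE.
by rewrite inE image_relE.
Qed.

Lemma far_image x y : far image_rel (f x) (f y) = far g x y.
Proof.
rewrite /far image_relE !nbhd_image -imsetI; last by move=> ? ? _ _; apply: f_inj.
by rewrite imset_eq0.
Qed.

Lemma trace_image x : nbhd image_rel (f x) :&: f @: S = f @: (nbhd g x :&: S).
Proof. by rewrite nbhd_image imsetI // => ? ? _ _; apply: f_inj. Qed.

Lemma filled_image :
  decomposable [rel x y : T' | far g x y] -> filled A set0 image_rel (f @: S).
Proof.
have inA u : u \in A -> exists x, u = f x by rewrite -fA => /imsetP[x _ ->]; exists x.
have AD : A :\: set0 = A by rewrite setD0.
move=> dec; rewrite /filled AD; split.
- split.
  + move=> u u'; apply/idP/idP => /image_relP[x [y [-> -> gxy]]];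
    by rewrite image_relE (graph5_sym g5).
  + by move=> u u' /image_relP[x [y [-> _ _]]]; rewrite -fA imset_f ?inE.
  + move=> u; apply/negP=> uu; have [x [y [ux _ _]]] := image_relP uu.
    by move: uu; rewrite ux image_relE; apply/negP; apply: graph5_irr g5 _.
  + by move=> _ /inA[x ->]; rewrite nbhd_image card_imset // (graph5_reg g5) ?inE.
  + move=> _ _ /image_relP[x [y [-> -> gxy]]]; rewrite !nbhd_image -imsetI; last first.
      by move=> ? ? _ _; apply: f_inj.
    by rewrite (graph5_C3 g5 gxy) imset0.
  + move=> u u' uu'; have [->|/set0Pn[z]] := eqVneq (nbhd image_rel u :&: nbhd image_rel u') set0.
      by rewrite cards0.
    rewrite !inE => /andP[/image_relP[x [_ [uE _ _]]] /image_relP[y [_ [uE' _ _]]]].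
    rewrite uE uE' !nbhd_image -imsetI; last by move=> ? ? _ _; apply: f_inj.
    rewrite card_imset //; apply: (graph5_C4 g5).
    by apply: contra_neq uu'; rewrite uE uE' => ->.
- split; first by rewrite -fA imsetS ?subsetT.
  move=> _ _ /inA[x ->] /inA[y ->] /=; rewrite !trace_image => /(imset_inj f_inj) /codeS.
  by move=> -> //; rewrite inE.
- apply: (decomposable_inj f_inj) dec => [x y _ /=|u u' _ /= /and3P[/inA[x ->] /inA[y ->] _]].
    by rewrite -fA !imset_f ?inE // far_image.
  by rewrite !codom_f.
Qed.

End Transport.

Lemma uniq_flatten_map (I J : eqType) (F : I -> seq J) (s : seq I) (i i' : I) (j : J) :
  uniq (flatten [seq F k | k <- s]) -> i \in s -> i' \in s -> j \in F i -> j \in F i' -> i = i'.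
Proof.
elim: s => //= k s IH; rewrite cat_uniq => /and3P[_ /hasPn dis u].
have notin l : l \in s -> j \in F l -> j \notin F k.
  by move=> ls jl; apply: dis; apply/flatten_mapP; exists l.
rewrite !inE => /predU1P[->|is_] /predU1P[->|is'] //.
- by move=> jk /(notin _ is'); rewrite jk.
- by move=> ji jk; have := notin _ is_ ji; rewrite jk.
- exact: IH.
Qed.

(** * Cyclic graphs with codes *)

Section CyclicPent.

Variables (lens : seq nat) (rows : seq (seq nat)) (bs : seq (seq nat * nat)) (S : seq nat).

(** [rows] holds the neighbours of the first point of each cycle. Developing a row over the length
    of its cycle lists the neighbourhoods of all its points in order. *)
Definition adjacency : seq (seq nat) := developed lens (zip rows lens).

(** The ball of radius 2 as a list with repetitions: it is free of duplicates only if no loop,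
    triangle or quadrangle passes through [x]. Its complement consists of the points far from
    [x]. *)
Definition ball (adj : seq (seq nat)) (x : nat) : seq nat :=
  x :: nth [::] adj x ++ flatten [seq [seq z <- nth [::] adj y | z != x] | y <- nth [::] adj x].

Definition cyclic_pent_check : bool :=
  let v := sumn lens in
  let adj := adjacency in
  let tr := [seq [seq z <- R | z \in S] | R <- adj] in
  [&& (0 < v) && (size adj == v),
      all (fun x => let R := nth [::] adj x in
        [&& size R == 4, all (gtn v) R, all (fun y => x \in nth [::] adj y) R &
          uniq (ball adj x)]) (iota 0 v),
      uniq S && all (gtn v) S,
      all (fun x => let t := nth [::] tr x in all (fun y => let t' := nth [::] tr y in
        (x == y) || ~~ (all (mem t') t && all (mem t) t')) (iota 0 v)) (iota 0 v) &
      cyclic_check lens bs [seq ball adj x | x <- iota 0 v]].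

Lemma cyclic_pent : cyclic_pent_check ->
  forall (T : finType) (A : {set T}), #|A| = sumn lens ->
  exists g S', [/\ filled A set0 g S', #|S'| = size S &
    all (has (mem S)) adjacency -> forall x, x \in A -> nbhd g x :&: S' != set0].
Proof.
set v := sumn lens; set adj := adjacency.
case/and5P=> /andP[v_gt0 /eqP size_adj] /allP adjP /andP[S_uniq S_lt] /allP trP.
move=> /decomposable_cyclic dec T A cardA.
have {}adjP x : x < v -> [/\ size (nth [::] adj x) = 4, all (gtn v) (nth [::] adj x),
    forall y, y \in nth [::] adj x -> x \in nth [::] adj y & uniq (ball adj x)].
  by move=> xv; have := adjP x; rewrite mem_iota => /(_ xv)/and4P[/eqP ? ? /allP ? ?].
pose g : rel 'I_v := [rel x y | val y \in nth [::] adj (val x)].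
pose S0 := [set x : 'I_v | val x \in S].
have nbhdE x : nbhd g x = [set y : 'I_v | val y \in nth [::] adj (val x)].
  by apply/setP=> y; rewrite !inE.
have far_ball (x y : 'I_v) : x != y -> far g x y = (val y \notin ball adj (val x)).
  move=> xy; rewrite /ball inE eq_sym (inj_eq val_inj) (negPf xy) /= mem_cat negb_or /far.
  congr (_ && _); rewrite -[LHS]negbK; congr (~~ _); apply/set0Pn/flatten_mapP => [[z]|[z zx]].
    rewrite inE !nbhdE !inE => /andP[zx zy]; exists (val z) => //.
    have [_ _ /(_ _ zy) yz _] := adjP _ (ltn_ord y).
    by rewrite mem_filter yz andbT; apply: contra_neq xy => /val_inj ->.
  rewrite mem_filter => /andP[_ yz]; have [_ /allP/(_ _ zx) zv _ _] := adjP _ (ltn_ord x).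
  have [_ _ /(_ _ yz) zy _] := adjP _ zv.
  by exists (Ordinal (zv : z < v)); rewrite inE !nbhdE !inE zx.
have g_sym : symmetric g.
  have half x y : g x y -> g y x.
    by move=> /= xy; have [_ _ sy _] := adjP _ (ltn_ord x); apply: sy.
  by move=> x y; apply/idP/idP; apply: half.
have ball_uniq (x : 'I_v) : [/\ val x \notin nth [::] adj (val x), uniq (nth [::] adj (val x)),
    forall z, z \in nth [::] adj (val x) ->
      z \notin flatten [seq [seq z <- nth [::] adj y | z != val x] | y <- nth [::] adj (val x)] &
    uniq (flatten [seq [seq z <- nth [::] adj y | z != val x] | y <- nth [::] adj (val x)])].
  have [_ _ _] := adjP _ (ltn_ord x); rewrite /ball cons_uniq mem_cat negb_or cat_uniq.
  move=> /andP[/andP[? _] /and3P[? /hasPn dis ?]]; split=> // z zx.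
  by apply/negP=> /dis; rewrite /= zx.
have g5 : graph5 setT g.
  split=> //.
  - by move=> x; have [] := ball_uniq x.
  - move=> x _; rewrite nbhdE; have [_ x_uniq _ _] := ball_uniq x.
    have [x4 x_lt _ _] := adjP _ (ltn_ord x).
    by rewrite card_ord_seq.
  - move=> x y xy; apply/setP=> z; rewrite !nbhdE !inE; apply/negP=> /andP[zx zy].
    have [xx _ /(_ _ zx) /negP dis _] := ball_uniq x; apply: dis.
    apply/flatten_mapP; exists (val y) => //; rewrite mem_filter zy andbT.
    by apply: contraNneq xx => zxE; move: zx; rewrite zxE.
  - move=> x y xy; rewrite leqNgt; apply/negP=> /card_gt1P[z [z' []]].
    rewrite !nbhdE !inE => /andP[zx zy] /andP[zx' zy'] /eqP; apply.
    have [_ _ _ flat_uniq] := ball_uniq x; apply/val_inj.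
    have yx : val y != val x by rewrite eq_sym (inj_eq val_inj).
    (* [y] is adjacent to both [z] and [z']; if these differed, it would occur twice in the ball of
       [x]. *)
    apply: (uniq_flatten_map (j := val y) flat_uniq) => //.
      by rewrite mem_filter yx; have [_ _ -> //] := adjP _ (ltn_ord y).
    by rewrite mem_filter yx; have [_ _ -> //] := adjP _ (ltn_ord y).
have trace_mem (x z : 'I_v) :
    (z \in nbhd g x :&: S0) = (val z \in [seq z <- nth [::] adj x | z \in S]).
  by rewrite mem_filter inE nbhdE !inE andbC.
have trace_sub (x y : 'I_v) : nbhd g x :&: S0 = nbhd g y :&: S0 ->
    all (mem [seq z <- nth [::] adj y | z \in S]) [seq z <- nth [::] adj x | z \in S].
  move=> xy; apply/allP=> z zx; have [_ /allP x_lt _ _] := adjP _ (ltn_ord x).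
  have zv : z < v by apply: x_lt; move: zx; rewrite mem_filter => /andP[].
  by have := trace_mem x (Ordinal zv); rewrite xy trace_mem /= zx => ->.
have codeS : {in setT &, injective (fun x => nbhd g x :&: S0)}.
  move=> x y _ _ xy; have := trP (val x); rewrite mem_iota ltn_ord => /(_ isT)/allP/(_ (val y)).
  rewrite mem_iota ltn_ord => /(_ isT) /orP[/eqP/val_inj //|].
  by rewrite !(nth_map [::]) ?size_adj ?ltn_ord // !trace_sub.
pose f (x : 'I_v) := enum_val (cast_ord (esym cardA) x).
have f_inj : injective f by move=> x y /enum_val_inj /cast_ord_inj.
have fA : f @: setT = A.
  apply/setP=> u; apply/imsetP/idP => [[x _ ->]|uA]; first exact: enum_valP.
  by exists (cast_ord cardA (enum_rank_in uA u)); rewrite // /f cast_ordK enum_rankK_in.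
exists (image_rel f g), (f @: S0); split.
- apply: filled_image => //; apply: eq_decomposable dec => x y xy /=.
  by rewrite far_ball // (nth_map 0) ?size_iota // nth_iota.
- by rewrite card_imset // card_ord_seq.
- move=> /allP ne u; rewrite -fA => /imsetP[x _ ->]; rewrite trace_image // imset_eq0.
  have : has (mem S) (nth [::] adj x) by apply: ne; rewrite mem_nth // size_adj.
  move=> /hasP[z zx zS]; have [_ /allP/(_ _ zx) zv _ _] := adjP _ (ltn_ord x).
  apply/set0Pn; exists (Ordinal (zv : z < v)); rewrite trace_mem mem_filter zx andbT.
  exact: zS.
Qed.

Lemma cyclic_best_pent : cyclic_pent_check ->
    (2 * sumn lens <= 5 * size S + 2) && (5 * size S <= 2 * sumn lens + 2) ->
  best_pent (sumn lens).
Proof.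
move=> check /andP[size1 size2] T A /(cyclic_pent check)[g [S' [fA cardS' _]]].
by exists g, S'; rewrite cardS'.
Qed.

Lemma cyclic_fillable : cyclic_pent_check -> 5 * size S == 2 * sumn lens ->
  all (has (mem S)) adjacency -> fillable 0 (sumn lens).
Proof.
move=> check /eqP size_S ne T A Y YA /eqP; rewrite cards_eq0 => /eqP -> {Y YA}.
rewrite setD0 => cardA; have [g [S' [fA cardS' ne']]] := cyclic_pent check cardA.
by exists g, S'; split=> //; split; rewrite ?cardS' ?cardA //; apply: ne'.
Qed.

End CyclicPent.

(** * Base designs and geometries *)

(** The name [gdd_a_k_m] stands for the type $a^k m^1$. Each base block is followed by its orbit
    length, which is shorter than the long cycles when a smaller power of the shift fixes the
    block. *)
Lemma gdd_2_7_0 : gdd (wt (k := 7) 2 0).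
Proof.
apply: (@cyclic_gdd 14 7 1 [::]
    [:: ([:: 0; 1; 4; 6], 14)]).
by vm_compute.
Qed.

Lemma gdd_3_5_0 : gdd (wt (k := 5) 3 0).
Proof.
apply: (@cyclic_gdd 15 5 1 [::]
    [:: ([:: 0; 1; 3; 7], 15)]).
by vm_compute.
Qed.

Lemma gdd_5_13_0 : gdd (wt (k := 13) 5 0).
Proof.
apply: (@cyclic_gdd 65 13 1 [::]
    [:: ([:: 0; 9; 20; 41], 65); ([:: 0; 2; 27; 30], 65); ([:: 0; 1; 7; 49], 65); ([:: 0; 4; 12;
       22], 65); ([:: 0; 5; 19; 34], 65)]).
by vm_compute.
Qed.

Lemma gdd_3_3_3 : gdd (wt (k := 3) 3 3).
Proof.
apply: (@cyclic_gdd 3 1 3 [:: 1; 1; 1]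
    [:: ([:: 0; 3; 6; 9], 3); ([:: 0; 4; 8; 10], 3); ([:: 0; 5; 7; 11], 3)]).
by vm_compute.
Qed.

Lemma gdd_12_6_0 : gdd (wt (k := 6) 12 0).
Proof.
apply: (@cyclic_gdd 72 6 1 [::]
    [:: ([:: 0; 2; 7; 35], 72); ([:: 0; 3; 20; 49], 72); ([:: 0; 9; 31; 47], 72); ([:: 0; 1; 11;
       15], 72); ([:: 0; 8; 21; 53], 72)]).
by vm_compute.
Qed.

Lemma gdd_12_7_0 : gdd (wt (k := 7) 12 0).
Proof.
apply: (@cyclic_gdd 84 7 1 [::]
    [:: ([:: 0; 16; 33; 57], 84); ([:: 0; 1; 9; 38], 84); ([:: 0; 12; 25; 65], 84); ([:: 0; 3;
       26; 48], 84); ([:: 0; 4; 10; 15], 84); ([:: 0; 2; 20; 54], 84)]).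
by vm_compute.
Qed.

Lemma gdd_12_8_0 : gdd (wt (k := 8) 12 0).
Proof.
apply: (@cyclic_gdd 96 8 1 [::]
    [:: ([:: 0; 10; 29; 41], 96); ([:: 0; 9; 22; 45], 96); ([:: 0; 3; 14; 57], 96); ([:: 0; 1;
       27; 47], 96); ([:: 0; 7; 25; 59], 96); ([:: 0; 5; 35; 63], 96); ([:: 0; 2; 6; 81], 96)]).
by vm_compute.
Qed.

Lemma gdd_12_9_0 : gdd (wt (k := 9) 12 0).
Proof.
apply: (@cyclic_gdd 108 9 1 [::]
    [:: ([:: 0; 14; 34; 67], 108); ([:: 0; 1; 5; 96], 108); ([:: 0; 3; 11; 60], 108); ([:: 0;
       15; 37; 61], 108); ([:: 0; 2; 32; 58], 108); ([:: 0; 19; 40; 83], 108); ([:: 0; 7; 35;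
       77], 108); ([:: 0; 6; 16; 85], 108)]).
by vm_compute.
Qed.

Lemma gdd_12_10_0 : gdd (wt (k := 10) 12 0).
Proof.
apply: (@cyclic_gdd 120 10 1 [::]
    [:: ([:: 0; 12; 29; 98], 120); ([:: 0; 6; 39; 58], 120); ([:: 0; 1; 16; 42], 120); ([:: 0;
       4; 25; 92], 120); ([:: 0; 14; 37; 73], 120); ([:: 0; 11; 24; 55], 120); ([:: 0; 9; 27;
       72], 120); ([:: 0; 3; 38; 46], 120); ([:: 0; 2; 7; 56], 120)]).
by vm_compute.
Qed.

Lemma gdd_12_11_0 : gdd (wt (k := 11) 12 0).
Proof.
apply: (@cyclic_gdd 132 11 1 [::]
    [:: ([:: 0; 8; 38; 48], 132); ([:: 0; 9; 28; 63], 132); ([:: 0; 6; 27; 109], 132); ([:: 0;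
       15; 52; 72], 132); ([:: 0; 7; 31; 74], 132); ([:: 0; 1; 5; 18], 132); ([:: 0; 12; 26;
       68], 132); ([:: 0; 16; 41; 87], 132); ([:: 0; 3; 39; 73], 132); ([:: 0; 2; 49; 81], 132)]).
by vm_compute.
Qed.

Lemma gdd_12_12_0 : gdd (wt (k := 12) 12 0).
Proof.
apply: (@cyclic_gdd 144 12 1 [::]
    [:: ([:: 0; 21; 44; 107], 144); ([:: 0; 9; 20; 62], 144); ([:: 0; 7; 32; 111], 144); ([:: 0;
       10; 49; 67], 144); ([:: 0; 3; 38; 92], 144); ([:: 0; 5; 13; 93], 144); ([:: 0; 1; 15;
       46], 144); ([:: 0; 4; 30; 73], 144); ([:: 0; 27; 68; 97], 144); ([:: 0; 2; 19; 85], 144);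
       ([:: 0; 6; 22; 116], 144)]).
by vm_compute.
Qed.

Lemma gdd_12_13_0 : gdd (wt (k := 13) 12 0).
Proof.
apply: (@cyclic_gdd 156 13 1 [::]
    [:: ([:: 0; 5; 25; 92], 156); ([:: 0; 1; 29; 113], 156); ([:: 0; 3; 18; 132], 156); ([:: 0;
       17; 55; 102], 156); ([:: 0; 21; 56; 116], 156); ([:: 0; 16; 50; 99], 156); ([:: 0; 6; 68;
       82], 156); ([:: 0; 10; 22; 41], 156); ([:: 0; 4; 36; 81], 156); ([:: 0; 7; 58; 66], 156);
       ([:: 0; 23; 53; 86], 156); ([:: 0; 2; 11; 48], 156)]).
by vm_compute.
Qed.

Lemma gdd_12_14_0 : gdd (wt (k := 14) 12 0).
Proof.
apply: (@cyclic_gdd 168 14 1 [::]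
    [:: ([:: 0; 11; 23; 44], 168); ([:: 0; 10; 64; 86], 168); ([:: 0; 4; 43; 51], 168); ([:: 0;
       17; 35; 95], 168); ([:: 0; 5; 36; 77], 168); ([:: 0; 6; 40; 55], 168); ([:: 0; 7; 52;
       109], 168); ([:: 0; 9; 25; 88], 168); ([:: 0; 26; 58; 87], 168); ([:: 0; 19; 46; 120],
       168); ([:: 0; 20; 50; 103], 168); ([:: 0; 13; 37; 75], 168); ([:: 0; 1; 3; 100], 168)]).
by vm_compute.
Qed.

Lemma gdd_12_15_0 : gdd (wt (k := 15) 12 0).
Proof.
apply: (@cyclic_gdd 180 15 1 [::]
    [:: ([:: 0; 9; 23; 130], 180); ([:: 0; 5; 26; 69], 180); ([:: 0; 11; 44; 93], 180); ([:: 0;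
       20; 58; 134], 180); ([:: 0; 1; 19; 152], 180); ([:: 0; 6; 68; 84], 180); ([:: 0; 2; 41;
       83], 180); ([:: 0; 8; 35; 100], 180); ([:: 0; 17; 51; 125], 180); ([:: 0; 4; 56; 113],
       180); ([:: 0; 12; 25; 144], 180); ([:: 0; 7; 31; 110], 180); ([:: 0; 3; 40; 94], 180);
       ([:: 0; 10; 32; 127], 180)]).
by vm_compute.
Qed.

Lemma gdd_12_16_0 : gdd (wt (k := 16) 12 0).
Proof.
apply: (@cyclic_gdd 192 16 1 [::]
    [:: ([:: 0; 4; 22; 99], 192); ([:: 0; 6; 51; 125], 192); ([:: 0; 26; 69; 148], 192); ([:: 0;
       8; 33; 143], 192); ([:: 0; 19; 60; 136], 192); ([:: 0; 1; 40; 54], 192); ([:: 0; 9; 29;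
       171], 192); ([:: 0; 3; 84; 101], 192); ([:: 0; 12; 35; 90], 192); ([:: 0; 15; 62; 121],
       192); ([:: 0; 5; 68; 105], 192); ([:: 0; 28; 66; 131], 192); ([:: 0; 7; 31; 165], 192);
       ([:: 0; 10; 46; 150], 192); ([:: 0; 2; 13; 85], 192)]).
by vm_compute.
Qed.

Lemma gdd_12_17_0 : gdd (wt (k := 17) 12 0).
Proof.
apply: (@cyclic_gdd 204 17 1 [::]
    [:: ([:: 0; 4; 12; 100], 204); ([:: 0; 3; 90; 95], 204); ([:: 0; 18; 41; 94], 204); ([:: 0;
       19; 54; 84], 204); ([:: 0; 22; 91; 127], 204); ([:: 0; 33; 73; 140], 204); ([:: 0; 28;
       70; 149], 204); ([:: 0; 6; 43; 56], 204); ([:: 0; 1; 32; 143], 204); ([:: 0; 7; 16; 82],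
       204); ([:: 0; 20; 46; 126], 204); ([:: 0; 10; 24; 39], 204); ([:: 0; 21; 48; 166], 204);
       ([:: 0; 44; 89; 147], 204); ([:: 0; 11; 63; 144], 204); ([:: 0; 2; 49; 74], 204)]).
by vm_compute.
Qed.

Lemma gdd_12_18_0 : gdd (wt (k := 18) 12 0).
Proof.
apply: (@cyclic_gdd 216 18 1 [::]
    [:: ([:: 0; 16; 56; 82], 216); ([:: 0; 4; 14; 109], 216); ([:: 0; 30; 81; 130], 216); ([::
       0; 15; 60; 93], 216); ([:: 0; 22; 64; 137], 216); ([:: 0; 7; 104; 113], 216); ([:: 0; 28;
       76; 161], 216); ([:: 0; 19; 50; 118], 216); ([:: 0; 3; 23; 172], 216); ([:: 0; 21; 80;
       145], 216); ([:: 0; 5; 43; 75], 216); ([:: 0; 6; 41; 52], 216); ([:: 0; 27; 84; 147],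
       216); ([:: 0; 2; 39; 127], 216); ([:: 0; 1; 13; 155], 216); ([:: 0; 8; 25; 102], 216);
       ([:: 0; 24; 53; 182], 216)]).
by vm_compute.
Qed.

Lemma gdd_5_12_2 : gdd (wt (k := 12) 5 2).
Proof.
apply: (@cyclic_gdd 20 4 3 [:: 1; 1]
    [:: ([:: 0; 6; 42; 53], 20); ([:: 0; 9; 49; 50], 20); ([:: 0; 31; 46; 59], 20); ([:: 0; 2;
       7; 25], 20); ([:: 0; 3; 37; 54], 20); ([:: 0; 24; 43; 45], 20); ([:: 0; 33; 55; 58], 20);
       ([:: 20; 23; 34; 46], 20); ([:: 0; 21; 22; 52], 20); ([:: 0; 20; 35; 44], 20); ([:: 20;
       27; 40; 54], 20); ([:: 0; 1; 28; 30], 20); ([:: 0; 32; 48; 61], 20); ([:: 0; 39; 57; 60],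
       20); ([:: 40; 45; 50; 55], 5); ([:: 0; 10; 26; 36], 10)]).
by vm_compute.
Qed.

Lemma gdd_5_12_8 : gdd (wt (k := 12) 5 8).
Proof.
apply: (@cyclic_gdd 20 4 3 (nseq 8 1)
    [:: ([:: 0; 44; 47; 53], 20); ([:: 0; 1; 3; 14], 20); ([:: 0; 5; 41; 43], 20); ([:: 20; 21;
       43; 50], 20); ([:: 0; 32; 40; 59], 20); ([:: 0; 24; 57; 67], 20); ([:: 0; 25; 28; 46],
       20); ([:: 0; 20; 22; 27], 20); ([:: 0; 29; 35; 55], 20); ([:: 0; 23; 34; 48], 20); ([::
       0; 33; 50; 66], 20); ([:: 0; 37; 52; 65], 20); ([:: 0; 31; 42; 64], 20); ([:: 0; 30; 49;
       63], 20); ([:: 0; 21; 45; 62], 20); ([:: 0; 39; 51; 61], 20); ([:: 0; 38; 54; 60], 20);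
       ([:: 40; 45; 50; 55], 5); ([:: 0; 10; 26; 36], 10)]).
by vm_compute.
Qed.

Lemma gdd_5_9_2 : gdd (wt (k := 9) 5 2).
Proof.
apply: (@cyclic_gdd 15 3 3 [:: 1; 1]
    [:: ([:: 0; 1; 5; 29], 15); ([:: 0; 2; 25; 39], 15); ([:: 0; 19; 27; 35], 15); ([:: 0; 17;
       21; 38], 15); ([:: 0; 20; 22; 44], 15); ([:: 0; 16; 26; 36], 15); ([:: 0; 30; 31; 41],
       15); ([:: 0; 7; 32; 34], 15); ([:: 15; 16; 34; 42], 15); ([:: 0; 18; 33; 46], 15); ([::
       0; 15; 43; 45], 15)]).
by vm_compute.
Qed.

Lemma gdd_5_9_8 : gdd (wt (k := 9) 5 8).
Proof.
apply: (@cyclic_gdd 15 3 3 (nseq 8 1)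
    [:: ([:: 0; 26; 39; 52], 15); ([:: 0; 22; 37; 49], 15); ([:: 0; 18; 35; 51], 15); ([:: 0;
       19; 31; 50], 15); ([:: 0; 7; 20; 21], 15); ([:: 0; 17; 25; 27], 15); ([:: 0; 1; 5; 43],
       15); ([:: 15; 19; 37; 38], 15); ([:: 15; 31; 36; 44], 15); ([:: 0; 2; 32; 36], 15); ([::
       0; 15; 41; 48], 15); ([:: 0; 16; 40; 47], 15); ([:: 0; 24; 44; 46], 15); ([:: 0; 23; 33;
       45], 15)]).
by vm_compute.
Qed.

Lemma gdd_10_6_7 : gdd (wt (k := 6) 10 7).
Proof.
apply: (@cyclic_gdd 20 2 3 (nseq 7 1)
    [:: ([:: 0; 28; 40; 63], 20); ([:: 0; 25; 53; 65], 20); ([:: 0; 23; 54; 66], 20); ([:: 0;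
       35; 58; 59], 20); ([:: 20; 25; 41; 58], 20); ([:: 20; 23; 40; 49], 20); ([:: 0; 20; 50;
       64], 20); ([:: 0; 31; 32; 46], 20); ([:: 0; 9; 51; 56], 20); ([:: 0; 5; 21; 34], 20);
       ([:: 0; 3; 48; 55], 20); ([:: 0; 1; 39; 44], 20); ([:: 0; 7; 24; 33], 20); ([:: 0; 22;
       41; 62], 20); ([:: 0; 30; 57; 61], 20); ([:: 0; 27; 49; 60], 20)]).
by vm_compute.
Qed.

(** The exceptional group consists of a fixed point and a cycle of length 3. The fixed point [60]
    completes the two short orbits. *)
Lemma gdd_10_6_4 : gdd (wt (k := 6) 10 4).
Proof.
apply: (@cyclic_gdd 30 3 2 [:: 1; 3]
    [:: ([:: 0; 48; 52; 53], 30); ([:: 0; 1; 26; 45], 30); ([:: 0; 13; 43; 50], 30); ([:: 0; 7;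
       35; 54], 30); ([:: 0; 19; 55; 57], 30); ([:: 0; 28; 31; 39], 30); ([:: 0; 16; 56; 61],
       30); ([:: 0; 32; 46; 62], 30); ([:: 0; 22; 34; 51], 30); ([:: 30; 40; 50; 60], 10); ([::
       0; 10; 20; 60], 10)]).
by vm_compute.
Qed.

Lemma gdd_10_6_13 : gdd (wt (k := 6) 10 13).
Proof.
apply: (@cyclic_gdd 30 3 2 [:: 1; 3; 3; 3; 3]
    [:: ([:: 0; 32; 48; 49], 30); ([:: 0; 35; 40; 61], 30); ([:: 0; 16; 33; 55], 30); ([:: 0; 7;
       59; 63], 30); ([:: 0; 1; 26; 42], 30); ([:: 0; 28; 43; 54], 30); ([:: 0; 51; 53; 68],
       30); ([:: 0; 13; 57; 67], 30); ([:: 0; 19; 50; 64], 30); ([:: 0; 34; 38; 65], 30); ([::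
       0; 30; 37; 72], 30); ([:: 0; 22; 58; 71], 30); ([:: 30; 40; 50; 60], 10); ([:: 0; 10; 20;
       60], 10)]).
by vm_compute.
Qed.

Lemma fillable_65 : fillable 0 65.
Proof.
apply: (@cyclic_fillable (nseq 5 13)
    [:: [:: 2; 11; 51; 52]; [:: 19; 20; 49; 52]; [:: 31; 34; 43; 52]; [:: 1; 16; 35; 52]; [:: 0; 13; 26; 39]]
    [:: ([:: 0; 1; 43; 46], 13); ([:: 0; 3; 44; 59], 13); ([:: 0; 5; 19; 33], 13); ([:: 0; 6;
       35; 55], 13); ([:: 0; 16; 38; 57], 13); ([:: 0; 17; 25; 60], 13); ([:: 0; 18; 20; 36],
       13); ([:: 0; 21; 32; 61], 13); ([:: 0; 22; 30; 37], 13); ([:: 0; 23; 27; 47], 13); ([::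
       0; 24; 31; 53], 13); ([:: 0; 48; 50; 58], 13); ([:: 13; 16; 47; 51], 13); ([:: 13; 17;
       45; 64], 13); ([:: 13; 36; 38; 63], 13); ([:: 13; 40; 46; 57], 13); ([:: 26; 27; 45; 63],
       13); ([:: 26; 30; 40; 41], 13); ([:: 26; 42; 47; 54], 13); ([:: 52; 53; 55; 61], 13)]
    (* The code is the union of the last two of the five cycles, hence exactly 2/5 of the points. *)
    (iota 39 26)).
- by vm_compute.
- by vm_compute.
- by vm_compute.
Qed.

Lemma best_pent_56 : best_pent 56.
Proof.
apply: (@cyclic_best_pent (nseq 2 28)
    [:: [:: 4; 24; 28; 49]; [:: 0; 7; 38; 46]]
    [:: ([:: 0; 43; 54; 55], 28); ([:: 0; 1; 11; 16], 28); ([:: 0; 3; 9; 50], 28); ([:: 0; 29;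
       44; 48], 28); ([:: 0; 30; 33; 35], 28); ([:: 0; 2; 36; 42], 28); ([:: 0; 14; 37; 51],
       14)]
    [:: 0; 1; 8; 9; 11; 14; 15; 22; 23; 24; 25; 28; 29; 30; 37; 38; 41; 43; 44; 51; 52; 55]).
- by vm_compute.
- by vm_compute.
Qed.

Lemma best_pent_68 : best_pent 68.
Proof.
apply: (@cyclic_best_pent (nseq 2 34)
    [:: [:: 6; 28; 34; 38]; [:: 0; 30; 45; 57]]
    [:: ([:: 0; 5; 24; 41], 34); ([:: 0; 1; 21; 43], 34); ([:: 0; 3; 26; 63], 34); ([:: 0; 7;
       16; 46], 34); ([:: 0; 2; 35; 55], 34); ([:: 34; 37; 47; 53], 34); ([:: 0; 50; 58; 59],
       34); ([:: 0; 47; 52; 54], 34); ([:: 0; 17; 48; 65], 17)]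
    [:: 4; 5; 6; 11; 12; 14; 15; 16; 21; 22; 23; 28; 29; 30; 32; 33; 35; 36; 45; 46; 47; 52; 53;
       54; 62; 63; 64]).
- by vm_compute.
- by vm_compute.
Qed.

Lemma fillable_80 : fillable 0 80.
Proof.
apply: (@cyclic_fillable (nseq 2 40)
    [:: [:: 40; 50; 53; 69]; [:: 0; 11; 27; 30]]
    [:: ([:: 0; 46; 52; 64], 40); ([:: 0; 8; 17; 47], 40); ([:: 0; 6; 77; 78], 40); ([:: 0; 41;
       49; 74], 40); ([:: 0; 1; 15; 66], 40); ([:: 0; 2; 59; 63], 40); ([:: 0; 42; 68; 73], 40);
       ([:: 0; 18; 45; 62], 40); ([:: 0; 5; 12; 48], 40); ([:: 0; 4; 58; 60], 40); ([:: 0; 20;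
       55; 75], 20)]
    [:: 3; 4; 6; 9; 11; 12; 17; 18; 23; 24; 26; 29; 31; 32; 37; 38; 44; 47; 52; 53; 58; 59; 61;
       64; 65; 66; 67; 70; 72; 73; 78; 79]).
- by vm_compute.
- by vm_compute.
- by vm_compute.
Qed.

Lemma best_pent_92 : best_pent 92.
Proof.
apply: (@cyclic_best_pent (nseq 2 46)
    [:: [:: 46; 48; 54; 79]; [:: 0; 13; 38; 44]]
    [:: ([:: 0; 4; 28; 84], 46); ([:: 0; 7; 60; 77], 46); ([:: 0; 1; 17; 27], 46); ([:: 0; 5;
       68; 88], 46); ([:: 0; 11; 47; 50], 46); ([:: 0; 12; 71; 78], 46); ([:: 0; 55; 65; 74],
       46); ([:: 0; 3; 64; 76], 46); ([:: 0; 9; 49; 81], 46); ([:: 0; 51; 62; 67], 46); ([:: 0;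
       69; 87; 91], 46); ([:: 0; 14; 57; 58], 46); ([:: 0; 23; 52; 75], 23)]
    [:: 0; 1; 4; 7; 10; 11; 14; 17; 20; 21; 26; 27; 30; 31; 36; 37; 40; 43; 47; 48; 49; 50; 52;
       54; 57; 59; 61; 66; 68; 75; 77; 78; 79; 82; 84; 89; 91]).
- by vm_compute.
- by vm_compute.
Qed.

Lemma best_pent_104 : best_pent 104.
Proof.
apply: (@cyclic_best_pent (nseq 2 52)
    [:: [:: 52; 84; 87; 99]; [:: 0; 5; 17; 20]]
    [:: ([:: 0; 68; 72; 86], 52); ([:: 0; 54; 70; 78], 52); ([:: 0; 56; 57; 67], 52); ([:: 0;
       71; 90; 92], 52); ([:: 0; 58; 97; 103], 52); ([:: 0; 11; 24; 53], 52); ([:: 0; 1; 30;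
       60], 52); ([:: 0; 10; 73; 95], 52); ([:: 0; 6; 33; 102], 52); ([:: 0; 16; 64; 93], 52);
       ([:: 0; 8; 74; 83], 52); ([:: 0; 21; 76; 101], 52); ([:: 0; 2; 45; 91], 52); ([:: 0; 4;
       38; 65], 52); ([:: 0; 26; 62; 88], 26)]
    [:: 6; 8; 10; 12; 14; 16; 18; 20; 22; 24; 26; 28; 30; 32; 34; 36; 38; 40; 42; 44; 51; 52;
       56; 57; 60; 64; 66; 68; 70; 76; 78; 80; 82; 84; 86; 88; 89; 90; 92; 94; 98; 102]).
- by vm_compute.
- by vm_compute.
Qed.

(** * Assembling all orders *)

(** The types $12^4$ and $12^5$ arise from $3^4$ and $3^5$ with weight 4; the others are cyclic. *)
Lemma gdd_12 (j : nat) : 4 <= j <= 18 -> gdd (fun _ : 'I_j => 12).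
Proof.
have OA4 : orthogonal_array 4 4 by apply: (@orthogonal_array_prime_power 4 2 2).
case: j => [|[|[|[|[|[|j]]]]]] // jP.
- by apply: eq_gdd (gdd_scale OA4 gdd_3_3_3) => i; rewrite /wt; case: ifP.
- exact: gdd_scale OA4 ((gdd_const_wt _ _).1 gdd_3_5_0).
case: j jP => [|[|[|[|[|[|[|[|[|[|[|[|[|j]]]]]]]]]]]]] jP; try by lia.
- exact/gdd_const_wt/gdd_12_6_0.
- exact/gdd_const_wt/gdd_12_7_0.
- exact/gdd_const_wt/gdd_12_8_0.
- exact/gdd_const_wt/gdd_12_9_0.
- exact/gdd_const_wt/gdd_12_10_0.
- exact/gdd_const_wt/gdd_12_11_0.
- exact/gdd_const_wt/gdd_12_12_0.
- exact/gdd_const_wt/gdd_12_13_0.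
- exact/gdd_const_wt/gdd_12_14_0.
- exact/gdd_const_wt/gdd_12_15_0.
- exact/gdd_const_wt/gdd_12_16_0.
- exact/gdd_const_wt/gdd_12_17_0.
- exact/gdd_const_wt/gdd_12_18_0.
Qed.

Lemma orthogonal_array_4_5 : orthogonal_array 4 5.
Proof. exact: (@orthogonal_array_prime_power 4 5 1). Qed.

Lemma gdd_60 (j : nat) : 4 <= j <= 18 -> gdd (fun _ : 'I_j => 60).
Proof. by move=> /gdd_12; apply: gdd_scale orthogonal_array_4_5. Qed.

(** The first [k] groups of a transversal design get constant weight [a], the point [u] of the last
    group gets weight [W u]; a block through [u] then needs the type $a^k (W u)^1$. *)
Lemma gdd_wt_td (k q a : nat) (W : 'I_q -> nat) :
    orthogonal_array k.+1 q -> (forall u, gdd (wt (k := k) a (W u))) ->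
  gdd (wt (k := k) (q * a) (\sum_u W u)).
Proof.
move=> OA gW.
apply: eq_gdd (gdd_td (h := fun i u => if i < k then a else W u) OA _) => [i|j].
  by rewrite /wt; case: ifP => // _; rewrite sum_nat_const card_ord.
apply: eq_gdd (gW (j ord_max)) => i; rewrite /wt; case: ltnP => // ki.
by congr (W (j _)); apply/val_inj => /=; have := ltn_ord i; lia.
Qed.

Lemma sum_minn (q b d : nat) : \sum_(u < q) minn b (d - b * u) = minn d (b * q).
Proof.
by elim: q => [|q IH]; rewrite ?big_ord0 ?muln0 ?minn0 // big_ord_recr /= IH mulnS; lia.
Qed.

(* The weights [lo + st * minn b (d - b u)], [u < q], lie between [lo] and
   [lo + st b] and can be given any sum [q lo + st d] with [d <= q b]. *)
Lemma gdd_wt_range (k q a lo st b d : nat) :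
    orthogonal_array k.+1 q ->
    (forall t, t <= b -> gdd (wt (k := k) a (lo + st * t))) -> d <= b * q ->
  gdd (wt (k := k) (q * a) (q * lo + st * d)).
Proof.
move=> OA gt db; have <- : \sum_(u < q) (lo + st * minn b (d - b * u)) = q * lo + st * d.
  by rewrite big_split /= sum_nat_const card_ord -big_distrr sum_minn (minn_idPl db).
by apply: gdd_wt_td OA _ => u; apply: gt; apply: geq_minl.
Qed.

Lemma fillable_wt (k a m : nat) : gdd (wt (k := k) a m) -> fillable 0 a -> fillable m (k * a).
Proof.
move=> gw fa; have := fillable_gdd (i0 := ord_max) (y := 0) gw.
rewrite /wt /= ltnn add0n.
have -> : \sum_(i < k.+1 | i != ord_max) (if i < k then a else m) = k * a.
  rewrite big_mkcond big_ord_recr /= eqxx addn0 -[k in RHS]card_ord -sum_nat_const.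
  by apply: eq_bigr => i _; rewrite ltn_ord -val_eqE /= neq_ltn ltn_ord.
apply=> i; rewrite -val_eqE /= => ik; case: ltnP => // ki.
by have := ltn_ord i; lia.
Qed.

(** Over F_8, weight 10 turns six groups into groups of size 80, and the eight points of the seventh
    get weights 4, 7, 10 or 13. *)
Lemma fillable_480 (d : nat) : d <= 24 -> fillable (32 + 3 * d) 480.
Proof.
move=> d24; apply: (@fillable_wt 6 80) fillable_80.
apply: (@gdd_wt_range 6 8 10 4 3 3) d24; first exact: (@orthogonal_array_prime_power 7 2 3).
case=> [|[|[|[|//]]]] _.
- exact: gdd_10_6_4.
- exact: gdd_10_6_7.
(* For weight 10 in the last group the type is $10^7$, five times $2^7$. *)
- apply: eq_gdd (gdd_scale orthogonal_array_4_5 ((gdd_const_wt _ _).1 gdd_2_7_0)) => i.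
  by rewrite /wt; case: ifP.
- exact: gdd_10_6_13.
Qed.

Lemma orthogonal_array_13 (k : nat) : k <= 13 -> orthogonal_array k 13.
Proof. exact: (@orthogonal_array_prime_power k 13 1). Qed.

(** Over F_13, weight 5 is given to twelve groups and weights 2, 5 or 8 to the points of the
    last. *)
Lemma fillable_780 (d : nat) : d <= 26 -> fillable (26 + 3 * d) 780.
Proof.
move=> d26; apply: (@fillable_wt 12 65) fillable_65.
apply: (@gdd_wt_range 12 13 5 2 3 2) d26; first exact: orthogonal_array_13.
case=> [|[|[|//]]] _.
- exact: gdd_5_12_2.
- by apply: eq_gdd ((gdd_const_wt _ _).1 gdd_5_13_0) => i; rewrite /wt; case: ifP.
- exact: gdd_5_12_8.
Qed.

(** Only the weights 2 and 8 occur in the last group: weight 5 would need a design of type $5^{10}$,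
    whose 1125 pairs from distinct groups are not a multiple of 6. *)
Lemma fillable_585 (d : nat) : d <= 13 -> fillable (26 + 6 * d) 585.
Proof.
move=> d13; apply: (@fillable_wt 9 65) fillable_65.
apply: (@gdd_wt_range 9 13 5 2 6 1); [exact: orthogonal_array_13| |by rewrite mul1n].
case=> [|[|//]] _.
- exact: gdd_5_9_2.
- exact: gdd_5_9_8.
Qed.

Lemma fillable_truncated (p e y n0 : nat) (s : seq nat) :
    prime p -> 0 < e -> size s < minn 18 (p ^ e) -> all (leq^~ (p ^ e)) (n0 :: s) ->
    4 <= count_mem (p ^ e) (n0 :: s) -> (forall n, n \in s -> fillable y (60 * n)) ->
  fillable (y + 60 * n0) (60 * sumn s).
Proof.
move=> p_prime e_gt0; rewrite leq_min => /andP[s18 sq] le_s count_s; apply: fillable_step.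
apply: (gdd_truncated (s := n0 :: s) gdd_60 _ le_s count_s s18).
  by rewrite expn_gt0 prime_gt0.
exact: orthogonal_array_prime_power.
Qed.

(** * Splitting integers into group sizes *)

Definition small_sizes : seq nat := [:: 8; 13; 32; 40; 48; 52; 56; 64; 128; 256].

Definition take_part (st : nat * seq nat) (f : nat) : nat * seq nat :=
  if f <= st.1 then (st.1 - f, f :: st.2) else st.

(** For $n \ge 212$ the thresholds leave $n - 4q \ge 84$, where $84 = (8-1)(13-1)$ is the number
    from which on every integer is a sum of parts 8 and 13. *)
Definition small_exponent (n : nat) : nat :=
  if n < 340 then 5 else if n < 604 then 6 else if n < 1108 then 7 else 8.

(* With [b] copies of 13 (four of them merged into 52 when [52 <= q]) the rest
   of [n - 4 q] is a multiple of 8. *)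
Definition small_parts (n : nat) : seq nat :=
  let q := 2 ^ small_exponent n in
  (* 5 is the inverse of 13 modulo 8. *)
  let b := (5 * (n - 4 * q)) %% 8 in
  let ns := if (q == 32) || (b < 4) then nseq b 13 else 52 :: nseq (b - 4) 13 in
  let m := n - 4 * q - 13 * b in
  (* After copies of [q] the remainder is split greedily; once below 64 it is 56, 48, 40, 32 or at
     most three parts 8. *)
  (foldl take_part (m %% q, nseq (m %/ q) q ++ ns) [:: 128; 64; 56; 48; 40; 32; 8; 8; 8]).2.

Lemma small_partsP (n : nat) : 212 <= n < 2260 ->
  let q := 2 ^ small_exponent n in let ns := small_parts n in
  [/\ n = 4 * q + sumn ns, size ns <= 13, all (leq^~ q) ns & all (mem small_sizes) ns].
Proof.
suff /allP small : all (fun n => let q := 2 ^ small_exponent n in let ns := small_parts n in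
    [&& n == 4 * q + sumn ns, size ns <= 13, all (leq^~ q) ns & all (mem small_sizes) ns]) (iota 212 2048).
  move=> nP; have /small : n \in iota 212 2048 by rewrite mem_iota.
  by move=> /and4P[/eqP ? ? ? ?].
by vm_compute.
Qed.

(** The parts are the groups of a truncated design besides four complete ones, and each is small or
    accessible to induction. At most 13 of them leave room for one more group within the bound 18 of
    [gdd_60]. *)
Lemma parts (n : nat) : 212 <= n -> exists e ns,
  [/\ 5 <= e, n = 4 * 2 ^ e + sumn ns, size ns <= 13, all (leq^~ (2 ^ e)) ns &
      forall m, m \in 2 ^ e :: ns -> (m \in small_sizes) || (212 <= m < n)].
Proof.
move=> n_ge; have [n_lt|n_large] := ltnP n 2260.
  have [nE ns13 ns_le /allP small] := small_partsP (introT andP (conj n_ge n_lt)).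
  exists (small_exponent n), (small_parts n); split=> //.
    by rewrite /small_exponent; do 3 case: ifP => // _.
  move=> m; rewrite inE => /predU1P[->|/small /= -> //].
  by rewrite /small_exponent; do 3 case: ifP => // _.
(* [q] is the largest power of 2 with $4q + 212 \le n$. It is at least 512 because $2260 = 4 \cdot
   512 + 212$. *)
pose e := trunc_log 2 ((n - 212) %/ 4); pose q := 2 ^ e.
have q_le : q <= (n - 212) %/ 4 by apply: trunc_logP => //; lia.
have q_gt : (n - 212) %/ 4 < q * 2 by rewrite /q -expnSr; apply: trunc_log_ltn.
have e_ge : 9 <= e by apply: trunc_log_max => //; lia.
have q_ge : 512 <= q by rewrite -[512]/(2 ^ 9) leq_exp2l.
(* Copies of [q] are removed as long as at least 212 is left, so $212 \le \rho < q + 212$. *)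
pose c := (n - 4 * q - 212) %/ q; pose rho := n - 4 * q - c * q.
have c_le : c < 4 by rewrite ltn_divLR; lia.
have rhoE : rho = 212 + (n - 4 * q - 212) %% q.
  by have := divn_eq (n - 4 * q - 212) q; rewrite -/c /rho; lia.
have rho_lt : (n - 4 * q - 212) %% q < q by rewrite ltn_mod; lia.
have nE : n = 4 * q + (c * q + rho).
  by have := divn_eq (n - 4 * q - 212) q; rewrite -/c /rho; lia.
(* If [rho] exceeds [q], then [rho - 212] is below [q] and, as $q \ge 512$, still at least 212. *)
exists e, (nseq c q ++ (if rho <= q then [:: rho] else [:: 212; rho - 212])).
split=> //; rewrite -/q.
- lia.
- by rewrite sumn_cat sumn_nseq [n in LHS]nE; case: ifP => _ /=; lia.
- by rewrite size_cat size_nseq; case: ifP => _ /=; lia.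
- by rewrite all_cat all_nseq leqnn orbT /=; case: ifP => rho_q /=; lia.
- move=> m; rewrite inE mem_cat => /orP[/eqP ->|/orP[/nseqP[-> _]|]]; try by apply/orP; right; lia.
  case: ifP => rho_q; first by rewrite !inE => /eqP ->; apply/orP; right; lia.
  by rewrite !inE => /orP[] /eqP ->; apply/orP; right; lia.
Qed.

Section Fill.

Variable y : nat.
Hypothesis fill8 : fillable y (60 * 8).
Hypothesis fill13 : fillable y (60 * 13).

(** One of the four complete groups first joins the hole and is then filled by [fillable_trans]. *)
Lemma fillable_parts (p e : nat) (ns : seq nat) :
    prime p -> 0 < e -> size ns + 4 <= minn 18 (p ^ e) -> all (leq^~ (p ^ e)) ns ->
    (forall n, n \in p ^ e :: ns -> fillable y (60 * n)) ->
  fillable y (60 * (4 * p ^ e + sumn ns)).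
Proof.
move=> p_prime e_gt0 size_ns le_ns fq; set q := p ^ e in size_ns le_ns fq *.
have -> : 60 * (4 * q + sumn ns) = 60 * sumn [:: q, q, q & ns] + 60 * q by rewrite /=; lia.
apply: fillable_trans; last by apply: fq; rewrite inE eqxx.
apply: (fillable_truncated (p := p) (e := e)) => //=; rewrite -/q ?leqnn ?eqxx //.
- by move: size_ns; rewrite addnS addn3.
- by move=> n; rewrite !inE => nP; apply: fq; rewrite inE; case/or4P: nP => ->; rewrite ?orbT.
Qed.

(** Four to eight groups of size 8 over F_8 give 32, 40, 48, 56 and 64; four equal groups give 52,
    128 and 256 from 13, 32 and 64. *)
Lemma fillable_small (n : nat) : n \in small_sizes -> fillable y (60 * n).
Proof.
have f8 j : j <= 4 -> fillable y (60 * (32 + 8 * j)).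
  move=> j4; have := @fillable_parts 2 3 (nseq j 8); rewrite sumn_nseq.
  apply=> //; first by rewrite size_nseq; lia.
    by rewrite all_nseq orbT.
  by move=> m; rewrite inE => /predU1P[->|/nseqP[-> _]].
have f4 p e : prime p -> 0 < e -> 4 <= p ^ e ->
    fillable y (60 * p ^ e) -> fillable y (60 * (4 * p ^ e)).
  move=> p_prime e_gt0 pe fe; rewrite -[4 * _]addn0.
  apply: (@fillable_parts p e [::]) => //=; first by rewrite leq_min pe.
  by move=> m; rewrite inE => /eqP ->.
have f52 := @f4 13 1 isT isT isT fill13.
have f128 := @f4 2 5 isT isT isT (f8 0 isT).
have f256 := @f4 2 6 isT isT isT (f8 4 isT).
have f40 := f8 1 isT; have f48 := f8 2 isT; have f56 := f8 3 isT.
have f32 := f8 0 isT; have f64 := f8 4 isT.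
by rewrite !inE; do 9![case/predU1P => [-> //|]]; move=> /eqP ->.
Qed.

Lemma fillable_large (n : nat) : 212 <= n -> fillable y (60 * n).
Proof.
elim/ltn_ind: n => n IH n_ge; have [e [ns [e_ge nE size_ns le_ns nsP]]] := parts n_ge.
rewrite nE; apply: fillable_parts => //; first lia.
  have : 2 ^ 5 <= 2 ^ e by rewrite leq_exp2l.
  by rewrite leq_min; lia.
by move=> m /nsP/orP[/fillable_small //|/andP[m_ge m_lt]]; apply: IH.
Qed.

(** A further group of size [60 * t] stays unfilled and enlarges the hole; the bound on [t] ensures
    $t \le q$. *)
Lemma fillable_shifted (n t : nat) : 212 <= n -> t <= 32 -> fillable (y + 60 * t) (60 * n).
Proof.
move=> n_ge t_le; have [e [ns [e_ge nE size_ns le_ns nsP]]] := parts n_ge.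
have q_ge : 32 <= 2 ^ e by rewrite -[32]/(2 ^ 5) leq_exp2l.
have -> : n = sumn [:: 2 ^ e, 2 ^ e, 2 ^ e, 2 ^ e & ns] by rewrite nE /=; lia.
apply: (fillable_truncated (p := 2) (e := e)) => //=.
- lia.
- by rewrite leq_min; lia.
- by rewrite !leqnn le_ns (leq_trans t_le).
- by rewrite !eqxx; lia.
- move=> m; rewrite !inE => mP.
  have /nsP/orP[/fillable_small //|/andP[m_ge _]] : m \in 2 ^ e :: ns.
    by rewrite inE; move: mP; case: (m == _).
  exact: fillable_large.
Qed.

End Fill.

Lemma best_pent_special (i : nat) : i < 5 -> best_pent (56 + 12 * i).
Proof.
case: i => [|[|[|[|[|//]]]]] _.
- exact: best_pent_56.
- exact: best_pent_68.
- exact: best_pent_perfect fillable_80.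
- exact: best_pent_92.
- exact: best_pent_104.
Qed.

Lemma best_pent_even (i n : nat) :
  i < 5 -> 212 <= n -> best_pent (60 * n + (56 + 12 * i)).
Proof.
move=> i5 n_ge; apply: best_pent_fill (best_pent_special i5); apply: fillable_large n_ge.
  by rewrite (_ : 56 + 12 * i = 32 + 3 * (8 + 4 * i)); [apply: fillable_480; lia|lia].
by rewrite (_ : 56 + 12 * i = 26 + 3 * (10 + 4 * i)); [apply: fillable_780; lia|lia].
Qed.

Lemma best_pent_odd (i n : nat) :
  i < 5 -> 212 <= n -> best_pent (60 * n + (585 + (56 + 12 * i))).
Proof.
move=> i5 n_ge; apply: best_pent_fill.
  (* A hole of this size is beyond [fillable_480] and [fillable_780]. A group of 600 points is split
     off, and [41 + 12 * i] is in the range of both. *)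
  have -> : 585 + (56 + 12 * i) = 41 + 12 * i + 60 * 10 by lia.
  apply: fillable_shifted => //.
    by rewrite (_ : 41 + 12 * i = 32 + 3 * (3 + 4 * i)); [apply: fillable_480; lia|lia].
  by rewrite (_ : 41 + 12 * i = 26 + 3 * (5 + 4 * i)); [apply: fillable_780; lia|lia].
apply: best_pent_fill (best_pent_special i5).
by rewrite (_ : 56 + 12 * i = 26 + 6 * (5 + 2 * i)); [apply: fillable_585; lia|lia].
Qed.

Theorem theorem6p5 (r : nat) (hr : 5316 <= r)
    (hr4 : r = 0 %[mod 4] \/ r = 1 %[mod 4]) :
  exists (T : finType) (L : {set {set T}}),
    [/\ pentagonal_geometry L 4 r,
        girth_at_least (deficiency L) 5
      & exists S : {set T}, best_possible_code (deficiency L) 4 S].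
Proof.
apply: pentagonal_of_best_pent; have {}hr : 4 * 1329 <= r by exact: hr.
have [r0|r1] : r %% 4 = 0 \/ r %% 4 = 1 by case: hr4 => ->; [left|right].
  (* For $r = 4m$ there are $12m + 5$ points, and $585 + 56 = 12 \cdot 53 + 5$. *)
  pose i := (r %/ 4 - 53) %% 5; pose n := (r %/ 4 - 53) %/ 5.
  have -> : 3 * r + 5 = 60 * n + (585 + (56 + 12 * i)) by rewrite /n /i; lia.
  by apply: best_pent_odd; rewrite /n /i; lia.
(* For $r = 4m + 1$ there are $12m + 8$ points, and $56 = 12 \cdot 4 + 8$. *)
pose i := (r %/ 4 - 4) %% 5; pose n := (r %/ 4 - 4) %/ 5.
have -> : 3 * r + 5 = 60 * n + (56 + 12 * i) by rewrite /n /i; lia.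
by apply: best_pent_even; rewrite /n /i; lia.
Qed.
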